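(* Let $R,S$ be positive integers with $1\le S<R/2$, and let $a,b\in\mathbb{Z}$. Then, expanded in powers of $q$, the series \[ \frac{\mathrm{Sg}(a+b)}{(q^{-S},q^{R+S},q^R;q^R)_{\infty}(q^{R-2S},q^{R+2S};q^{2R})_{\infty}}\sum_{n=a}^{b}q^{n(3n+1)R/2}\left(q^{3nS}-q^{-(3n+1)S}\right) \] has non-negative coefficient of $q^k$ for every integer $k\ge 1$.
   Context: $\mathrm{Sg}(x)=1$ if $x\ge 0$ and $\mathrm{Sg}(x)=-1$ if $x<0$. $(x;q)_\infty=\prod_{i\ge1}(1-xq^{i-1})$ and $(x_1,\dots,x_m;q)_\infty=\prod_{j=1}^m(x_j;q)_\infty$. An empty sum (when $a>b$) is $0$. *)

(* Defs.v *)
From HB Require Import structures.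
From mathcomp Require Import all_boot all_order all_algebra.
From mathcomp Require Import boolp classical_sets functions cardinality.
From mathcomp Require Import fsbigop set_interval.
From mathcomp Require Import zify.

Set Implicit Arguments.
Unset Strict Implicit.
Unset Printing Implicit Defensive.

Import Order.TTheory GRing.Theory Num.Theory.
Local Open Scope classical_set_scope.
Local Open Scope ring_scope.

(* The field F((q)) of formal Laurent series in q.  "Expanding in powers of q"
   an expression built from powers of q, infinite products and quotients means
   evaluating it in this field. *)

Definition vanish_below (F : fieldType) (f : int -> F) (m : int) :=
  forall k, k < m -> f k = 0.

Record laurent (F : fieldType) := Laurent {
  lcoef : int -> F;
  _ : exists m, vanish_below lcoef m }.

Section PowerSeries.
Variable F : fieldType.
Implicit Types f g h : nat -> F.

Definition psmul f g n : F := \sum_(i < n.+1) f i * g (n - i)%N.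

Lemma psmulE f g n N : (n < N)%N ->
  psmul f g n = ((\poly_(i < N) f i) * (\poly_(i < N) g i))`_n.
Proof.
move=> nN; rewrite coefM; apply: eq_bigr => i _.
by rewrite !coef_poly !ifT //; have := ltn_ord i; lia.
Qed.

Lemma psmulC f g n : psmul f g n = psmul g f n.
Proof. by rewrite !(@psmulE _ _ _ n.+1) // mulrC. Qed.

Lemma psmulA f g h n : psmul f (psmul g h) n = psmul (psmul f g) h n.
Proof.
pose P u := \poly_(i < n.+1) (u i : F).
transitivity ((P f * (P g * P h))`_n); last rewrite mulrA.
  rewrite coefM; apply: eq_bigr => i _.
  rewrite [(P f)`__]coef_poly ltn_ord (@psmulE g h _ n.+1) //.
  by rewrite ltnS leq_subr.
rewrite coefM; apply: eq_bigr => i _.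
rewrite [(P h)`__]coef_poly ltnS leq_subr (@psmulE f g _ n.+1) //.
Qed.

Lemma psmulV f : f 0%N != 0 ->
  exists g, forall n, psmul f g n = (n == 0)%:R.
Proof.
move=> f0.
pose step (s : seq F) :=
  rcons s ((f 0%N)^-1 * ((size s == 0)%:R
    - \sum_(i < size s) f i.+1 * s`_(size s - i.+1))).
pose s n := iter n step [::].
have szs n : size (s n) = n by elim: n => //= n IH; rewrite size_rcons IH.
pose g n := (s n.+1)`_n.
have gE n j : (j < n)%N -> (s n)`_j = g j.
  elim: n => // n IH; rewrite ltnS leq_eqVlt => /predU1P[-> // | jn].
  by rewrite /= nth_rcons szs jn IH.
exists g => n; rewrite /psmul big_ord_recl subn0.
rewrite {1}/g /= nth_rcons szs ltnn eqxx mulVKf //.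
rewrite (eq_bigr (fun i : 'I_n => f i.+1 * g (n - i.+1)%N)); last first.
  by move=> i _; rewrite gE //; have := ltn_ord i; lia.
by rewrite subrK.
Qed.

End PowerSeries.

Section LaurentField.
Variable F : fieldType.
Local Notation L := (laurent F).
Implicit Types f g h : L.

HB.instance Definition _ := gen_eqMixin L.
HB.instance Definition _ := gen_choiceMixin L.

Lemma laurentP f g : (forall k, lcoef f k = lcoef g k) -> f = g.
Proof.
case: f g => [f pf] [g pg] /= /funext fg; subst g.
by congr Laurent; apply: Prop_irrelevance.
Qed.

Lemma vanish_belowW (u : int -> F) m n :
  n <= m -> vanish_below u m -> vanish_below u n.
Proof. by move=> nm um k kn; apply: um; apply: lt_le_trans nm. Qed.

Lemma lcoef_bounded f : exists m, vanish_below (lcoef f) m.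
Proof. by case: f. Qed.

Lemma lcoef_bounded2 f g :
  exists m, vanish_below (lcoef f) m /\ vanish_below (lcoef g) m.
Proof.
have [m fm] := lcoef_bounded f; have [n gn] := lcoef_bounded g.
exists (Num.min m n); split.
  by apply: vanish_belowW fm; rewrite ge_min lexx.
by apply: vanish_belowW gn; rewrite ge_min lexx orbT.
Qed.

Fact lzero_subproof : exists m, vanish_below (fun=> 0 : F) m.
Proof. by exists 0. Qed.
Definition lzero : L := Laurent lzero_subproof.

(* the monomial q^m *)
Fact lmonom_subproof (m : int) :
  exists n, vanish_below (fun k => (k == m)%:R : F) n.
Proof. by exists m => k km; rewrite lt_eqF. Qed.
Definition lmonom m : L := Laurent (lmonom_subproof m).

Fact ladd_subproof f g : exists m, vanish_below (fun k => lcoef f k + lcoef g k) m.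
Proof.
have [m [fm gm]] := lcoef_bounded2 f g.
by exists m => k km; rewrite fm // gm // addr0.
Qed.
Definition ladd f g : L := Laurent (ladd_subproof f g).

Fact lopp_subproof f : exists m, vanish_below (fun k => - lcoef f k) m.
Proof.
by have [m fm] := lcoef_bounded f; exists m => k km; rewrite fm // oppr0.
Qed.
Definition lopp f : L := Laurent (lopp_subproof f).

(* Only finitely many terms of the convolution are nonzero, see lconvE. *)
Definition lconv (u v : int -> F) (k : int) : F :=
  \sum_(i \in [set: int]) u i * v (k - i).

Definition ptail (u : int -> F) (m : int) (n : nat) : F := u (m + n%:Z).

Lemma lconv_outside (u v : int -> F) m n k i :
  vanish_below u m -> vanish_below v n ->
  i \notin [seq m + j%:Z | j <- iota 0 k.+1] -> u i * v (m + n + k%:Z - i) = 0.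
Proof.
move=> um vn; have [im _ | mi] := ltP i m; first by rewrite um ?mul0r.
have [ik | ki _] := leP i (m + k%:Z); last by rewrite vn ?mulr0 //; lia.
case/mapP; exists (absz (i - m)); last by lia.
by rewrite mem_iota; lia.
Qed.

Lemma lconv_vanish (u v : int -> F) m n : vanish_below u m -> vanish_below v n ->
  vanish_below (lconv u v) (m + n).
Proof.
move=> um vn k kmn; rewrite /lconv fsbig1 // => i _.
have [im | mi] := ltP i m; first by rewrite um ?mul0r.
by rewrite vn ?mulr0 //; lia.
Qed.

Lemma lconvE (u v : int -> F) m n k : vanish_below u m -> vanish_below v n ->
  lconv u v (m + n + k%:Z) = psmul (ptail u m) (ptail v n) k.
Proof.
move=> um vn; rewrite /lconv.
rewrite (fsbigE [seq m + i%:Z | i <- iota 0 k.+1]) //; last 2 first.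
- have inj : injective (fun i : nat => m + i%:Z) by move=> i j; lia.
  exact: etrans (map_inj_uniq inj _) (iota_uniq _ _).
- by move=> i _; exact: lconv_outside.
rewrite (eq_bigl xpredT) => [|i]; last by rewrite in_setT.
rewrite (big_map (fun i : nat => m + i%:Z) xpredT
  (fun i => u i * v (m + n + k%:Z - i))).
rewrite /psmul -(big_mkord xpredT
  (fun i => ptail u m i * ptail v n (k - i)%N)) /index_iota subn0.
rewrite big_seq [RHS]big_seq; apply: eq_bigr => i; rewrite mem_iota => ik.
by congr (_ * v _); lia.
Qed.

Lemma lconvTE (u v : int -> F) m n : vanish_below u m -> vanish_below v n ->
  ptail (lconv u v) (m + n) = psmul (ptail u m) (ptail v n).
Proof. by move=> um vn; apply/funext => k; rewrite -lconvE. Qed.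

Lemma eq_ptail (u v : int -> F) m : vanish_below u m -> vanish_below v m ->
  ptail u m =1 ptail v m -> u =1 v.
Proof.
move=> um vm uv k; have [km | mk] := ltP k m; first by rewrite um // vm.
by have := uv (absz (k - m)); rewrite /ptail; have -> : m + `|k - m|%N = k by lia.
Qed.

Fact lmul_subproof f g : exists m, vanish_below (lconv (lcoef f) (lcoef g)) m.
Proof.
have [m [fm gm]] := lcoef_bounded2 f g.
by exists (m + m); apply: lconv_vanish.
Qed.
Definition lmul f g : L := Laurent (lmul_subproof f g).

Lemma laddA : associative ladd.
Proof. by move=> f g h; apply: laurentP => k /=; rewrite addrA. Qed.
Lemma laddC : commutative ladd.
Proof. by move=> f g; apply: laurentP => k /=; rewrite addrC. Qed.
Lemma ladd0 : left_id lzero ladd.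
Proof. by move=> f; apply: laurentP => k /=; rewrite add0r. Qed.
Lemma laddN : left_inverse lzero lopp ladd.
Proof. by move=> f; apply: laurentP => k /=; rewrite addNr. Qed.

HB.instance Definition _ := GRing.isZmodule.Build L laddA laddC ladd0 laddN.

Lemma lmulC : commutative lmul.
Proof.
move=> f g; have [m [fm gm]] := lcoef_bounded2 f g.
apply: laurentP; apply: (@eq_ptail _ _ (m + m)); try exact: lconv_vanish.
by move=> k; rewrite /= !lconvTE // psmulC.
Qed.

Lemma lmulA : associative lmul.
Proof.
move=> f g h; have [m [fm gm]] := lcoef_bounded2 f g.
have [n hn] := lcoef_bounded h.
apply: laurentP; apply: (@eq_ptail _ _ (m + (m + n))).
- by do 2![apply: lconv_vanish => //].
- by rewrite addrA; do 2![apply: lconv_vanish => //].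
move=> k; transitivity (ptail (lconv (lconv (lcoef f) (lcoef g)) (lcoef h))
    (m + m + n) k); last by rewrite addrA.
rewrite [LHS](congr1 (@^~ k) (lconvTE fm (lconv_vanish gm hn))) !lconvTE //.
  exact: psmulA.
exact: lconv_vanish.
Qed.

Lemma lmul1 : left_id (lmonom 0) lmul.
Proof.
move=> f; have [m fm] := lcoef_bounded f.
have v1 : vanish_below (lcoef (lmonom 0)) 0 by move=> k k0; rewrite /= lt_eqF.
apply: laurentP; apply: (@eq_ptail _ _ (0 + m)); first exact: lconv_vanish.
  by rewrite add0r.
move=> k; rewrite lconvTE // /psmul big_ord_recl big1 ?addr0 => [|i _].
  by rewrite [X in X * _](_ : _ = 1) // mul1r add0r subn0.
by rewrite [X in X * _](_ : _ = 0) ?mul0r.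
Qed.

Lemma lmulDl : left_distributive lmul +%R.
Proof.
move=> f g h; have [m [fm gm]] := lcoef_bounded2 f g.
have [n hn] := lcoef_bounded h.
have fgm : vanish_below (lcoef (f + g)) m.
  by move=> k km; rewrite /= fm // gm // addr0.
apply: laurentP; apply: (@eq_ptail _ _ (m + n)); first exact: lconv_vanish.
  by move=> k km; rewrite /= !(@lconv_vanish _ _ m n) ?addr0.
move=> k; rewrite lconvTE //.
transitivity (psmul (ptail (lcoef f) m) (ptail (lcoef h) n) k +
              psmul (ptail (lcoef g) m) (ptail (lcoef h) n) k).
  by rewrite -big_split; apply: eq_bigr => i _; rewrite /= -mulrDl.
by rewrite -!lconvTE.
Qed.

Lemma lone_neq0 : lmonom 0 != 0.
Proof. by apply/eqP => /(congr1 (@lcoef F ^~ 0))/eqP; rewrite /= oner_eq0. Qed.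

HB.instance Definition _ := GRing.Zmodule_isComNzRing.Build L
  lmulA lmulC lmul1 lmulDl lone_neq0.

Definition linv f : L := xget 0 [set g | g * f = 1].

Lemma lmulV f : f != 0 -> linv f * f = 1.
Proof.
move=> f0; apply: (@xgetPex _ 0 [set g | g * f = 1]).
have [m fm] := lcoef_bounded f.
have exk : exists i, lcoef f (m + i%:Z) != 0.
  apply: contrapT => /forallNP fN; case/eqP: f0; apply: laurentP.
  apply: (eq_ptail fm) => // i.
  by apply/eqP; have /negP := fN i; rewrite negbK.
pose j := ex_minn exk; have [/= fj jmin] : lcoef f (m + j%:Z) != 0 /\
    forall i, lcoef f (m + i%:Z) != 0 -> (j <= i)%N.
  by rewrite /j; case: ex_minnP.
have vf : vanish_below (lcoef f) (m + j%:Z).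
  move=> k kmj; have [km | mk] := ltP k m; first exact: fm.
  apply/eqP; apply: contraTT kmj => fk; rewrite -leNgt.
  have /jmin : lcoef f (m + `|k - m|%N%:Z) != 0.
    by have -> : m + `|k - m|%N%:Z = k by lia.
  lia.
have [|g gP] := @psmulV F (ptail (lcoef f) (m + j%:Z)).
  by rewrite /ptail addr0.
pose d := m + j%:Z.
pose u k := if k < - d then 0 else g (absz (k + d)).
have ud : vanish_below u (- d) by move=> k kd; rewrite /u kd.
exists (Laurent (ex_intro _ _ ud)) => /=; rewrite mulrC.
apply: laurentP; apply: (@eq_ptail _ _ (d - d)).
- exact: lconv_vanish.
- by rewrite subrr => k k0; rewrite /= lt_eqF.
move=> k; rewrite lconvTE //; have -> : ptail u (- d) = g.
  by apply/funext => i; rewrite /ptail /u ifF; [congr g|]; lia.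
by rewrite gP /ptail subrr add0r.
Qed.

Lemma linv0 : linv 0 = 0.
Proof.
rewrite /linv; case: xgetP => // g _ /= /eqP.
by rewrite mulr0 eq_sym oner_eq0.
Qed.

HB.instance Definition _ := GRing.ComNzRing_isField.Build L lmulV linv0.

Definition lq : L := lmonom 1.

(* q-adic convergence; limits are unique, and [llim u] is 0 when [u] diverges. *)
Definition lcvg (u : nat -> L) (l : L) :=
  forall k : int, exists N, forall n, (N <= n)%N ->
    forall j, j <= k -> lcoef (u n) j = lcoef l j.

Definition llim (u : nat -> L) : L := xget 0 [set l | lcvg u l].

(* (x; y)_oo, with the product indexed from 0 *)
Definition qpoch (x y : L) : L :=
  llim (fun n => \prod_(i < n) (1 - x * y ^+ i)).

(* (x_1, ..., x_m; y)_oo *)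
Definition qpochs (xs : seq L) (y : L) : L := \prod_(x <- xs) qpoch x y.

End LaurentField.

Arguments lq {F}.

Definition Sg (x : int) : int := if 0 <= x then 1 else -1.

(* Main.v *)
(* With Q = q^R, z = q^S and
     P = (-z, -Q/z; Q)_oo / ((Q; Q)_oo (z^2, Q/z^2; Q)_oo),
   the series is Sg(a+b) times the sum of the P T_n, a <= n <= b, where
     T_n = Q^(n(3n+1)/2) (z^(-3n) - z^(3n+1)).
   The factor 1/(1 - z) of P makes P T_n nonnegative for n >= 0 and nonpositive
   for n < 0, so it suffices to show, for all N, that 1 minus the sum of P T_n
   over -N-1 <= n <= N and the sum over -N <= n <= N minus 1 are nonnegative.
   Both follow from finite forms of the quintuple product identity, with
   products of length M and q-binomial coefficients.  Passing from M to M + 1, the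
   truncated sum of a finite form changes only by a boundary term, because the
   increments of its terms telescope; this boundary term is symmetric under
   z -> 1/z and is a positive combination of symmetrizations of
     z^(-p) / ((1 - z) (Q^e / z^2; Q)_n),  p >= 0, e >= 1,
   which are nonnegative since (z^(-p) - z^(p+1)) / (1 - z) is.  Let M -> oo. *)
From HB Require Import structures.
Require Import Defs.
From mathcomp Require Import all_boot all_order all_algebra.
From mathcomp Require Import boolp classical_sets fsbigop set_interval.
From mathcomp Require Import zify ring.
Set Implicit Arguments.
Unset Strict Implicit.
Unset Printing Implicit Defensive.

Import Order.TTheory GRing.Theory Num.Theory.
Local Open Scope classical_set_scope.
Local Open Scope ring_scope.

(** * Finite q-products and two finite forms of the quintuple product identity, over any field *)

Section FiniteForms.
Variables (K : fieldType) (q : K).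

Definition po (x : K) (n : nat) : K := \prod_(i < n) (1 - x * q ^+ i).

(* The q-binomial coefficient [n + m choose n]. *)
Definition qbin (n m : nat) : K := po q (n + m) / (po q n * po q m).

Lemma po0 x : po x 0 = 1. Proof. by rewrite /po big_ord0. Qed.

Lemma poS x n : po x n.+1 = po x n * (1 - x * q ^+ n).
Proof. by rewrite /po big_ord_recr. Qed.

Lemma poSl x n : po x n.+1 = (1 - x) * po (x * q) n.
Proof.
rewrite /po big_ord_recl expr0 mulr1; congr (_ * _); apply: eq_bigr => i _.
by rewrite exprS mulrA.
Qed.

Lemma poD x n m : po x (n + m) = po x n * po (x * q ^+ n) m.
Proof.
elim: m => [|m IH]; first by rewrite addn0 /po big_ord0 mulr1.
by rewrite addnS !poS IH -!mulrA -exprD.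
Qed.

(** Keeps every denominator of the finite forms away from zero. The condition is symmetric under
    [w -> w^-1], so each identity can be used at both points. *)
Definition generic (w : K) :=
  [/\ w != 0, q != 0, forall i, q ^+ i.+1 != 1, forall i, w ^+ 2 * q ^+ i != 1
    & forall i, w ^- 2 * q ^+ i != 1].

Lemma genericV w : generic w -> generic w^-1.
Proof.
case=> w0 q0 qi wi wVi; split=> //; first by rewrite invr_eq0.
  by move=> i; rewrite exprVn.
by move=> i; rewrite exprVn invrK.
Qed.

(** The exponent n(3n+1)/2 of the series at n = j >= 0. The halving is exact because
    [j * (3 * j + 1)] is even. *)
Definition pent (j : nat) : nat := (j * (3 * j + 1))./2.

Lemma pentS j : pent j.+1 = (pent j + (3 * j + 2))%N.
Proof.
rewrite /pent -[RHS](@doubleK); congr half; rewrite doubleD.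
have : ~~ odd (j * (3 * j + 1)) by rewrite oddM oddD oddM /=; case: (odd j).
by move=> /even_halfK ->; lia.
Qed.

(* Finite form for truncations ending at a negative index: the [fterm M j w] and
   [fterm M j w^-1], 0 <= j <= M, add up to 1, see [fsum_full].  It comes from
     sum_k [n choose k] (1 - x^2 q^(2k+1)) (-x)^k q^(k^2) (-xq; q)_n
           / (x^2 q^(k+1); q)_(n+1) = 1
   with n = 2M+1, x = q^(-M-1) / w, k = M+1+j.  [fcert] is the telescoping
   certificate of the step M -> M+1. *)
Definition fterm (M j : nat) (w : K) : K :=
  qbin (M.+1 + j) (M - j) * (q ^+ pent j * w ^- (3 * j))
  * (1 - q ^+ (2 * j).+1 / w ^+ 2) * (po (- w) M.+1 * po (- (q / w)) M)
  / (po (w ^+ 2) (M.+1 - j) * po (q / w ^+ 2) (M + j).+1).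

Definition fcert (M J : nat) (w : K) : K :=
  - (q ^+ (pent J + M.+1) * w ^- (3 * J)) * (po (- w) M.+1 * po (- (q / w)) M)
  / po (q / w ^+ 2) (M + J).+1
  * (qbin (M + J) (M.+1 - J) / po (w ^+ 2) (M.+1 - J)
       * (q ^- J * (1 + q ^+ J / w))
     + qbin (M.+1 + J) (M.+1 - J) / po (w ^+ 2) (M.+2 - J)
       * (w * (1 + w / q ^+ J) * (1 + q ^+ M.+1 / w))).

(* Finite form for truncations ending at a nonnegative index, from
     sum_k [n choose k] (1 - x q^k) (-x)^k q^(k^2) (-x; q)_(n+1)
           / (x^2 q^k; q)_(n+1) = 1
   with n = 2M, x = q^(-M) / w, k = M+j.  [gcert M i] is the certificate at the
   boundary between the terms i and i+1. *)
Definition gterm (M j : nat) (w : K) : K :=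
  qbin (M + j) (M - j) * (q ^+ pent j * w ^- (3 * j))
  * (1 - w / q ^+ j) * (po (- w) M.+1 * po (- (q / w)) M)
  / (po (w ^+ 2) (M.+1 - j) * po (q / w ^+ 2) (M + j)).

Definition gcert (M i : nat) (w : K) : K :=
  q ^+ (pent i + i + M.+1) * w ^- (3 * i + 2)
  * (po (- w) M.+1 * po (- (q / w)) M) / po (q / w ^+ 2) (M + i).+1
  * (qbin (M + i) (M - i) / po (w ^+ 2) (M - i)
     + qbin (M + i).+1 (M - i) / po (w ^+ 2) (M.+1 - i)
       * (w ^+ 2 * (1 + q ^+ M.+1 / w))).

Lemma po_neq0 x n : (forall i, x * q ^+ i != 1) -> po x n != 0.
Proof.
by move=> h; apply/prodf_neq0 => i _; rewrite subr_eq0 eq_sym h.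
Qed.

(** * Telescoping certificates for the step from [M] to [M.+1] *)

Section Generic.
Variable w : K.
Hypothesis gw : generic w.

Lemma w_neq0 : w != 0. Proof. by case: gw. Qed.
Lemma q_neq0 : q != 0. Proof. by case: gw. Qed.
Lemma poq_neq0 n : po q n != 0.
Proof. by case: gw => _ _ h _ _; apply: po_neq0 => i; rewrite -exprS. Qed.
Lemma pow2_neq0 n : po (w ^+ 2) n != 0.
Proof. by case: gw => _ _ _ h _; apply: po_neq0. Qed.
Lemma poqw2_neq0 n : po (q / w ^+ 2) n != 0.
Proof.
case: gw => _ _ _ _ h; apply: po_neq0 => i.
by rewrite mulrAC -exprS mulrC.
Qed.
Lemma q1_neq0 n : 1 - q ^+ n.+1 != 0.
Proof. by case: gw => _ _ h _ _; rewrite subr_eq0 eq_sym. Qed.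
Lemma w2_neq0 n : 1 - w ^+ 2 * q ^+ n != 0.
Proof. by case: gw => _ _ _ h _; rewrite subr_eq0 eq_sym. Qed.
Lemma qw2_neq0 n : w ^+ 2 - q ^+ n != 0.
Proof.
case: gw => w0 _ _ _ h; rewrite subr_eq0; apply: contraNneq (h n) => <-.
by rewrite mulVf // expf_neq0.
Qed.

Lemma fterm_step M j : (j <= M)%N ->
  fterm M.+1 j w - fterm M j w = fcert M j.+1 w - fcert M j w.
Proof.
(* Writing [M = j + d] removes the truncated subtractions, and every product becomes a common
   shorter one times explicit factors. *)
move=> jM; have [d ->] : exists d, M = (j + d)%N by exists (M - j)%N; lia.
rewrite /fterm /fcert.
have -> : ((j + d).+1 - j = d.+1)%N by lia.
have -> : ((j + d).+1 - j.+1 = d)%N by lia.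
have -> : ((j + d).+2 - j.+1 = d.+1)%N by lia.
have -> : ((j + d).+2 - j = d.+2)%N by lia.
have -> : (j + d - j = d)%N by lia.
have -> : ((j + d).+2 + j = (j + d + j).+2)%N by lia.
have -> : ((j + d).+1 + j.+1 = (j + d + j).+2)%N by lia.
have -> : ((j + d).+1 + j = (j + d + j).+1)%N by lia.
have -> : (j + d + j.+1 = (j + d + j).+1)%N by lia.
rewrite /qbin.
have -> : ((j + d + j).+2 + d.+1 = (j + d + j + d).+3)%N by lia.
have -> : ((j + d + j).+1 + d = (j + d + j + d).+1)%N by lia.
have -> : ((j + d + j).+2 + d = (j + d + j + d).+2)%N by lia.
have -> : ((j + d + j).+1 + d.+1 = (j + d + j + d).+2)%N by lia.
have -> : (j + d + j + d.+1 = (j + d + j + d).+1)%N by lia.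
rewrite pentS; have -> : (3 * j.+1 = 3 * j + 3)%N by lia.
have -> : (3 * j + 2 = (j + (j + j)).+2)%N by lia.
have -> : ((2 * j).+1 = (j + j).+1)%N by lia.
have := q1_neq0 d; have := q1_neq0 (j + d + j); have := q1_neq0 (j + d + j).+1.
have := w2_neq0 d; have := w2_neq0 d.+1; have := qw2_neq0 (j + d + j).+1.
have := qw2_neq0 (j + d + j).+2; have := pow2_neq0 d.
have := poqw2_neq0 (j + d + j); have := poq_neq0 d; have := poq_neq0 (j + d + j).
have := w_neq0; have := q_neq0.
rewrite !poS.
set A := po (w ^+ 2) d; set B := po (q / w ^+ 2) (j + d + j).
set C := po q d; set D := po q (j + d + j); set E := po q _.
set F := po (- w) _; set G := po (- (q / w)) _.
have : w ^+ j != 0 by rewrite expf_neq0 ?w_neq0.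
have : q ^+ j != 0 by rewrite expf_neq0 ?q_neq0.
rewrite !(exprS, exprD, expr0, mulr1).
set u := q ^+ d; set v := q ^+ j; set X := q ^+ pent j; set Y := w ^+ j.
(* With the products and powers generalized to independent letters, this is an identity of rational
   functions. *)
clearbody A B C D E F G u v X Y => *; field.
by rewrite ?oner_neq0 ?andbT; do ?[apply/andP; split].
Qed.

Lemma qbin0 n : qbin n 0 = 1.
Proof.
by rewrite /qbin addn0 po0 mulr1 divff // poq_neq0.
Qed.

(** At length [M.+1] one new term enters the full sum; the upper boundary term is exactly its
    negative, so the total is preserved. *)
Lemma fcert_edge M : fcert M M.+1 w = - fterm M.+1 M.+1 w.
Proof.
rewrite /fterm /fcert !subnn.
have -> : (M.+2 - M.+1 = 1)%N by lia.
have -> : ((2 * M.+1).+1 = (M + M).+3)%N by lia.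
have -> : ((M + M.+1).+1 = (M + M).+2)%N by lia.
have -> : ((M.+1 + M.+1).+1 = (M + M).+3)%N by lia.
rewrite !qbin0 !poS.
have := qw2_neq0 (M + M).+2; have := qw2_neq0 (M + M).+1.
have := qw2_neq0 (M + M).+3; have := poqw2_neq0 (M + M).
have := w2_neq0 0; have := w_neq0; have := q_neq0.
have : w ^+ (3 * M.+1) != 0 by rewrite expf_neq0 ?w_neq0.
have : q ^+ M != 0 by rewrite expf_neq0 ?q_neq0.
set B := po (q / w ^+ 2) (M + M); set Y := w ^+ (3 * M.+1).
rewrite po0.
set F := po (- w) _; set G := po (- (q / w)) _.
rewrite !(exprS, exprD, expr0, mulr1).
set X := q ^+ pent _; set v := q ^+ M.
clearbody B F G v X Y => *; field.
by rewrite ?oner_neq0 ?andbT; do ?[apply/andP; split].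
Qed.

Lemma gterm_step M i : (i < M)%N ->
  gterm M.+1 i.+1 w - gterm M i.+1 w = gcert M i.+1 w - gcert M i w.
Proof.
move=> jM; have [d ->] : exists d, M = (i + d).+1 by exists (M - i).-1; lia.
rewrite /gterm /gcert.
have -> : ((i + d).+2 - i.+1 = d.+1)%N by lia.
have -> : ((i + d).+1 - i.+1 = d)%N by lia.
have -> : ((i + d).+3 - i.+1 = d.+2)%N by lia.
have -> : ((i + d).+1 - i = d.+1)%N by lia.
have -> : ((i + d).+2 - i = d.+2)%N by lia.
have -> : ((i + d).+2 + i.+1 = (i + d + i).+3)%N by lia.
have -> : ((i + d).+1 + i.+1 = (i + d + i).+2)%N by lia.
have -> : ((i + d).+1 + i = (i + d + i).+1)%N by lia.
rewrite /qbin.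
have -> : ((i + d + i).+3 + d.+1 = (i + d + i + d).+4)%N by lia.
have -> : ((i + d + i).+2 + d = (i + d + i + d).+2)%N by lia.
have -> : ((i + d + i).+3 + d = (i + d + i + d).+3)%N by lia.
have -> : ((i + d + i).+1 + d.+1 = (i + d + i + d).+2)%N by lia.
have -> : ((i + d + i).+2 + d.+1 = (i + d + i + d).+3)%N by lia.
rewrite pentS.
have -> : (3 * i.+1 = (i + (i + i)).+3)%N by lia.
have -> : (3 * i + 2 = (i + (i + i)).+2)%N by lia.
have := q1_neq0 d; have := q1_neq0 (i + d + i); have := q1_neq0 (i + d + i).+1.
have := q1_neq0 (i + d + i).+2.
have := w2_neq0 d; have := w2_neq0 d.+1; have := qw2_neq0 (i + d + i).+1.
have := qw2_neq0 (i + d + i).+2; have := pow2_neq0 d.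
have := qw2_neq0 (i + d + i).+3.
have := poqw2_neq0 (i + d + i); have := poq_neq0 d; have := poq_neq0 (i + d + i).
have := w_neq0; have := q_neq0.
rewrite !poS.
set A := po (w ^+ 2) d; set B := po (q / w ^+ 2) (i + d + i).
set C := po q d; set D := po q (i + d + i); set E := po q _.
set F := po (- w) _; set G := po (- (q / w)) _.
have : w ^+ i != 0 by rewrite expf_neq0 ?w_neq0.
have : q ^+ i != 0 by rewrite expf_neq0 ?q_neq0.
rewrite !(exprS, exprD, expr0, mulr1).
set u := q ^+ d; set v := q ^+ i; set X := q ^+ pent i; set Y := w ^+ i.
clearbody A B C D E F G u v X Y => *; field.
by rewrite ?oner_neq0 ?andbT; do ?[apply/andP; split].
Qed.

Lemma gcert_edge M : gcert M M w = - gterm M.+1 M.+1 w.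
Proof.
rewrite /gterm /gcert !subnn.
have -> : (M.+2 - M.+1 = 1)%N by lia.
have -> : (M.+1 - M = 1)%N by lia.
have -> : (M.+1 + M.+1 = (M + M).+2)%N by lia.
rewrite !qbin0 !poS pentS.
have -> : (3 * M.+1 = (M + (M + M)).+3)%N by lia.
have -> : (3 * M + 2 = (M + (M + M)).+2)%N by lia.
have := qw2_neq0 (M + M).+2; have := qw2_neq0 (M + M).+1.
have := poqw2_neq0 (M + M).
have := w2_neq0 0; have := w_neq0; have := q_neq0.
have : w ^+ M != 0 by rewrite expf_neq0 ?w_neq0.
have : q ^+ M != 0 by rewrite expf_neq0 ?q_neq0.
rewrite po0.
set F := po (- w) _; set G := po (- (q / w)) _.
set B := po (q / w ^+ 2) (M + M).
rewrite !(exprS, exprD, expr0, mulr1).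
set X := q ^+ pent _; set v := q ^+ M; set Y := w ^+ M.
clearbody B F G v X Y => *; field.
by rewrite ?oner_neq0 ?andbT; do ?[apply/andP; split].
Qed.

End Generic.

(** * Symmetrization under [w -> w^-1] *)

Section Symmetric.
Variable w : K.
Hypothesis gw : generic w.

Lemma po_numV M : po (- w^-1) M.+1 * po (- (q / w^-1)) M =
  w^-1 * (po (- w) M.+1 * po (- (q / w)) M).
Proof.
rewrite !poSl invrK !mulNr (mulrC _ q) (mulrC w q).
by move: (w_neq0 gw) => w0; field.
Qed.

Lemma po_denVl n : po (w^-1 ^+ 2) n.+1 = (1 - w ^- 2) * po (q / w ^+ 2) n.
Proof. by rewrite poSl exprVn (mulrC _ q). Qed.

(** Variant of [po_denVl] for a length that is not a successor: the last factor is added and divided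
    out again. *)
Lemma po_denVl' n : po (w^-1 ^+ 2) n =
  (1 - w ^- 2) * po (q / w ^+ 2) n / (1 - w ^- 2 * q ^+ n).
Proof.
rewrite -po_denVl poS exprVn mulfK //; case: gw => _ _ _ _ h.
by rewrite subr_eq0 eq_sym.
Qed.

Lemma po_denVr n : (1 - w ^+ 2) * po (q / w^-1 ^+ 2) n = po (w ^+ 2) n.+1.
Proof. by rewrite poSl exprVn invrK (mulrC q). Qed.

Lemma w21_neq0 : 1 - w ^+ 2 != 0.
Proof. by have := w2_neq0 gw 0; rewrite expr0 mulr1. Qed.

Lemma po_denVr' n : po (q / w^-1 ^+ 2) n = po (w ^+ 2) n.+1 / (1 - w ^+ 2).
Proof. by rewrite -po_denVr mulrAC divff ?mul1r // w21_neq0. Qed.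

Lemma w1_neq0 : 1 - w != 0.
Proof.
apply: contraNneq w21_neq0 => h.
have -> : 1 - w ^+ 2 = (1 - w) * (1 + w) by ring.
by rewrite h mul0r.
Qed.

(** The building block of the boundary terms. By itself it need not have nonnegative coefficients;
    its symmetrization does. *)
Definition core (e n p : nat) (x : K) : K :=
  x ^- p / ((1 - x) * po (q ^+ e / x ^+ 2) n).

(** This is 1/(1 - y) = 1 + y/(1 - y) for the last factor, y = q^(e+n)/w^2; the w^(-2) in y raises
    [p] by 2. *)
Lemma core_rec e n p :
  core e n.+1 p w = core e n p w + q ^+ (e + n) * core e n.+1 p.+2 w.
Proof.
rewrite /core poS.
have := w1_neq0; have := qw2_neq0 gw (e + n); have := w_neq0 gw.
have : po (q ^+ e / w ^+ 2) n != 0.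
  apply: po_neq0 => i; case: gw => _ _ _ _ h.
  by rewrite mulrAC -exprD mulrC.
have : w ^+ p != 0 by rewrite expf_neq0 // (w_neq0 gw).
set A := po _ _; rewrite !(exprS, exprD, expr0, mulr1).
set Y := w ^+ p; set u := q ^+ e; set v := q ^+ n.
clearbody A Y u v => *; field.
by rewrite ?oner_neq0 ?andbT; do ?[apply/andP; split].
Qed.

(** Since 1/(1 - 1/w) = -w/(1 - w), the left side is (w^(-p) - w^(p+1))/(1 - w), a finite geometric
    sum running from w^(-p) to w^p. *)
Lemma geom_symmetric p : w ^- p / (1 - w) + w ^+ p / (1 - w^-1) =
  w ^- p * \sum_(i < (2 * p).+1) w ^+ i.
Proof.
have w1 := w1_neq0; have w1' : w - 1 != 0 by rewrite -opprB oppr_eq0.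
have -> : \sum_(i < (2 * p).+1) w ^+ i = (w ^+ (2 * p).+1 - 1) / (w - 1).
  by rewrite subrX1 mulrAC divff // mul1r.
rewrite mul2n -addnn exprS exprD; have := w_neq0 gw.
have : w ^+ p != 0 by rewrite expf_neq0 // (w_neq0 gw).
set Y := w ^+ p; clearbody Y => *; field.
by rewrite ?oner_neq0 ?andbT; do ?[apply/andP; split].
Qed.

(** The lower boundary of the telescoping disappears after symmetrization, so only the upper
    boundary contributes to [fsum_step]. *)
Lemma fcert0 M : fcert M 0 w + fcert M 0 w^-1 = 0.
Proof.
rewrite /fcert !subn0 po_numV !po_denVl !po_denVr' !addn0 /qbin !(addnS, addSn) !poS.
rewrite muln0 !expr0.
have := w21_neq0; have := qw2_neq0 gw 0; have := w_neq0 gw; have := q_neq0 gw.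
have := poqw2_neq0 gw M; have := pow2_neq0 gw M.
have := poq_neq0 gw M; have := poq_neq0 gw (M + M).
have := qw2_neq0 gw M.+1; have := w2_neq0 gw M; have := w2_neq0 gw M.+1.
have := q1_neq0 gw M.
set A := po (w ^+ 2) M; set B := po (q / w ^+ 2) M.
set C := po q M; set D := po q (M + M).
set F := po (- w) _; set G := po (- (q / w)) _.
rewrite !(exprS, exprD, expr0, mulr1).
set v := q ^+ M.
clearbody A B C D F G v => *. field.
by rewrite ?oner_neq0 ?andbT; do ?[apply/andP; split].
Qed.

(** The term of index 0 occurs unpaired in [gsum]; its increment is the symmetrized boundary term
    that starts the telescoping. *)
Lemma gterm_step0 M :
  gterm M.+1 0 w - gterm M 0 w = gcert M 0 w + gcert M 0 w^-1.
Proof.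
rewrite /gterm /gcert !subn0 !addn0 po_numV !po_denVl !po_denVr' /qbin.
rewrite !(addnS, addSn) !muln0 !expr0 (po_denVl' M) !poS.
have := qw2_neq0 gw M.
have := w21_neq0; have := qw2_neq0 gw 0; have := w_neq0 gw; have := q_neq0 gw.
have := poqw2_neq0 gw M; have := pow2_neq0 gw M.
have := poq_neq0 gw M; have := poq_neq0 gw (M + M).
have := qw2_neq0 gw M.+1; have := w2_neq0 gw M; have := w2_neq0 gw M.+1.
have := q1_neq0 gw M.
set A := po (w ^+ 2) M; set B := po (q / w ^+ 2) M.
set C := po q M; set D := po q (M + M).
set F := po (- w) _; set G := po (- (q / w)) _.
rewrite !(exprS, exprD, expr0, mulr1).
set v := q ^+ M.
clearbody A B C D F G v => *; field.
by rewrite ?oner_neq0 ?andbT; do ?[apply/andP; split].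
Qed.

(** The part of a boundary term that is invariant under [x -> x^-1]; it factors out of the
    symmetrization. [pair_factor] below is the next pair of factors of its denominator. *)
Definition weight (M d : nat) (x : K) : K :=
  po (- (x * q)) M * po (- (x^-1 * q)) M
  / (po (x ^+ 2 * q) d * po (x ^- 2 * q) d).

Lemma weightV M d : weight M d w^-1 = weight M d w.
Proof.
rewrite /weight exprVn !invrK (mulrC (po (- (w^-1 * q)) M)).
by rewrite (mulrC (po (w ^- 2 * q) d)).
Qed.

Definition pair_factor (d : nat) (x : K) : K :=
  ((1 - x ^+ 2 * q ^+ d.+1) * (1 - x ^- 2 * q ^+ d.+1))^-1.

Lemma pair_factorV d : pair_factor d w^-1 = pair_factor d w.
Proof. by rewrite /pair_factor exprVn invrK mulrC. Qed.

Lemma poq_shift_neq0 e n : po (q ^+ e / w ^+ 2) n != 0.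
Proof.
apply: po_neq0 => i; case: gw => _ _ _ _ h.
by rewrite mulrAC -exprD mulrC.
Qed.

Lemma po2q_neq0 n : po (w ^+ 2 * q) n != 0.
Proof. by have := pow2_neq0 gw n.+1; rewrite poSl mulf_eq0 negb_or => /andP[]. Qed.

Lemma poq2_neq0 n : po (w ^- 2 * q) n != 0.
Proof. by rewrite mulrC; apply: poqw2_neq0. Qed.

Lemma po_num_split M : po (- w) M.+1 * po (- (q / w)) M =
  (1 + w) * (po (- (w * q)) M * po (- (w^-1 * q)) M).
Proof. by rewrite poSl opprK mulNr (mulrC q) mulrA. Qed.

Lemma po_den_split d : po (w ^+ 2) d.+1 = (1 - w ^+ 2) * po (w ^+ 2 * q) d.
Proof. by rewrite poSl. Qed.

Lemma po_den_splitr d n : po (q / w ^+ 2) (d + n) =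
  po (w ^- 2 * q) d * po (q ^+ d.+1 / w ^+ 2) n.
Proof. by rewrite poD (mulrC q) -mulrA -exprS (mulrC _ (w ^- 2)). Qed.

Lemma po_den_next d n : po (q ^+ d / w ^+ 2) n.+1 =
  (1 - q ^+ d / w ^+ 2) * po (q ^+ d.+1 / w ^+ 2) n.
Proof. by rewrite poSl mulrAC -exprSr. Qed.

Lemma qbin0l m : qbin 0 m = 1.
Proof. by rewrite /qbin po0 mul1r divff // (poq_neq0 gw). Qed.

(** The q-Pascal rule, from which the q-binomial coefficients inherit nonnegativity. *)
Lemma qbinS n m :
  qbin n.+1 m.+1 = qbin n m.+1 + q ^+ n.+1 * qbin n.+1 m.
Proof.
rewrite /qbin !(addnS, addSn) !poS.
have := poq_neq0 gw n; have := poq_neq0 gw m.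
have := q1_neq0 gw n; have := q1_neq0 gw m.
rewrite !(exprS, exprD, expr0, mulr1).
set A := po q n; set B := po q m; set C := po q _.
set u := q ^+ n; set v := q ^+ m.
clearbody A B C u v => *; field.
by rewrite ?oner_neq0 ?andbT; do ?[apply/andP; split].
Qed.

Lemma fterm_diag J :
  fterm J J w = weight J 0 w * q ^+ pent J * core 1 (2 * J) (3 * J) w.
Proof.
rewrite /fterm /weight /core subnn subSnn (qbin0 gw) po_num_split po_den_split.
have -> : (J + J).+1 = (0 + (2 * J).+1)%N by lia.
rewrite po_den_splitr poS !po0.
have := w1_neq0; have := w21_neq0; have := w_neq0 gw.
have := qw2_neq0 gw (2 * J).+1; have := poq_shift_neq0 1 (2 * J).
have : w ^+ (3 * J) != 0 by rewrite expf_neq0 // (w_neq0 gw).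
set A := po _ (2 * J); set B := po _ J; set C := po _ J.
set Y := w ^+ (3 * J); rewrite !(exprS, exprD, expr0, mulr1).
set X := q ^+ pent J; set u := q ^+ (2 * J).
clearbody A B C Y X u => *; field.
by rewrite ?oner_neq0 ?andbT; do ?[apply/andP; split].
Qed.

Lemma gterm_diag i : gterm i.+1 i.+1 w =
  - (weight i 0 w * (q ^+ pent i.+1 * q ^- i.+1)
     * (core 1 (2 * i).+1 (3 * i + 2) w
        + q ^+ i.+1 * core 1 (2 * i).+1 (3 * i).+1 w)).
Proof.
rewrite /gterm /weight /core subnn subSnn (qbin0 gw) po_num_split po_den_split.
have -> : (i.+1 + i.+1 = 0 + (2 * i).+2)%N by lia.
have -> : (3 * i.+1 = 3 * i + 3)%N by lia.
rewrite po_den_splitr !(poS _ i) (poS _ (2 * i).+1) !po0.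
have := w1_neq0; have := w21_neq0; have := w_neq0 gw; have := q_neq0 gw.
have := qw2_neq0 gw (i + i).+2; have := poq_shift_neq0 1 (2 * i).+1.
have : w ^+ i != 0 by rewrite expf_neq0 // (w_neq0 gw).
have : q ^+ i != 0 by rewrite expf_neq0 // (q_neq0 gw).
set A := po _ (2 * i).+1; set B := po _ i; set C := po _ i.
set X := q ^+ pent i.+1.
have -> : ((2 * i).+1 = (i + i).+1)%N by lia.
rewrite !(exprS, exprD, expr0, mulr1).
set Y := w ^+ i; set u := q ^+ i.
clearbody A B C Y X u => *; field.
by rewrite ?oner_neq0 ?andbT; do ?[apply/andP; split].
Qed.

(** The quotient (1 + w)/(1 - w^2) gives the 1/(1 - w) of [core]. The first [d] factors of each
    denominator product go into [weight], the next pair into [pair_factor], and the remaining ones,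
    in q/w^2, into [core]. Expanding the brackets of [fcert] yields the several values of [p]. *)
Lemma fcert_core N d (M := (N.+1 + d)%N) : fcert M N.+1 w =
  - (weight M d w * q ^+ (pent N.+1 + M.+1)
     * (qbin (M + N.+1) d.+1 * q ^- N.+1
          * (core d.+1 (2 * N).+3 (3 * N + 3) w
             + q ^+ N.+1 * core d.+1 (2 * N).+3 (3 * N + 4) w)
        + qbin (M.+1 + N.+1) d.+1 * pair_factor d w
          * (core d.+2 (2 * N).+2 (3 * N + 2) w
             + q ^- N.+1 * core d.+2 (2 * N).+2 (3 * N).+1 w
             + q ^+ M.+1 * core d.+2 (2 * N).+2 (3 * N + 3) w
             + q ^- N.+1 * q ^+ M.+1 * core d.+2 (2 * N).+2 (3 * N + 2) w))).
Proof.
rewrite /fcert /weight /core /pair_factor po_num_split.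
have -> : (M.+1 - N.+1 = d.+1)%N by rewrite /M; lia.
have -> : (M.+2 - N.+1 = d.+2)%N by rewrite /M; lia.
have -> : ((M + N.+1).+1 = d + (2 * N).+3)%N by rewrite /M; lia.
have -> : (3 * N.+1 = 3 * N + 3)%N by lia.
rewrite po_den_splitr (po_den_next _ (2 * N).+2) !po_den_split (poS _ d).
have := w1_neq0; have := w21_neq0; have := w_neq0 gw; have := q_neq0 gw.
have := qw2_neq0 gw d.+1; have := w2_neq0 gw d.+1.
have := poq_shift_neq0 d.+2 (2 * N).+2.
have := po2q_neq0 d; have := poq2_neq0 d.
have : w ^+ N != 0 by rewrite expf_neq0 // (w_neq0 gw).
have : q ^+ N != 0 by rewrite expf_neq0 // (q_neq0 gw).
set A := po _ (2 * N).+2; set B := po _ M; set C := po _ M.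
set D := po _ d; set E := po _ d.
set b1 := qbin _ _; set b2 := qbin _ _; set X := q ^+ (_ + _); set V := q ^+ M.+1.
rewrite !(exprS, exprD, expr0, mulr1).
set Y := w ^+ N; set u := q ^+ N; set v := q ^+ d.
clearbody A B C D E b1 b2 X V Y u v => *; field.
by rewrite ?oner_neq0 ?andbT; do ?[apply/andP; split].
Qed.

Lemma gcert_core i d (M := (i.+1 + d)%N) : gcert M i w =
  weight M d w * q ^+ (pent i + i + M.+1)
  * (qbin (M + i) d.+1 * core d.+1 (2 * i).+2 (3 * i + 2) w
     + qbin (M + i).+1 d.+1 * pair_factor d w
       * (core d.+2 (2 * i).+1 (3 * i) w
          + q ^+ M.+1 * core d.+2 (2 * i).+1 (3 * i).+1 w)).
Proof.
rewrite /gcert /weight /core /pair_factor po_num_split.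
have -> : (M - i = d.+1)%N by rewrite /M; lia.
have -> : (M.+1 - i = d.+2)%N by rewrite /M; lia.
have -> : ((M + i).+1 = d + (2 * i).+2)%N by rewrite /M; lia.
rewrite po_den_splitr (po_den_next _ (2 * i).+1) !po_den_split (poS _ d).
have := w1_neq0; have := w21_neq0; have := w_neq0 gw; have := q_neq0 gw.
have := qw2_neq0 gw d.+1; have := w2_neq0 gw d.+1.
have := poq_shift_neq0 d.+2 (2 * i).+1.
have := po2q_neq0 d; have := poq2_neq0 d.
have : w ^+ i != 0 by rewrite expf_neq0 // (w_neq0 gw).
set A := po _ (2 * i).+1; set B := po _ M; set C := po _ M.
set D := po _ d; set E := po _ d.
set b1 := qbin _ _; set b2 := qbin _ _; set X := q ^+ (_ + _); set V := q ^+ M.+1.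
rewrite !(exprS, exprD, expr0, mulr1).
set Y := w ^+ i; set v := q ^+ d.
clearbody A B C D E b1 b2 X V Y v => *; field.
by rewrite ?oner_neq0 ?andbT; do ?[apply/andP; split].
Qed.

Definition fsum J M := \sum_(j < J) (fterm M j w + fterm M j w^-1).
Definition gsum J M :=
  gterm M 0 w + \sum_(j < J) (gterm M j.+1 w + gterm M j.+1 w^-1).

Lemma fsum_step J M : (J <= M.+1)%N ->
  fsum J M.+1 - fsum J M = fcert M J w + fcert M J w^-1.
Proof.
elim: J => [_|J IH lJ]; first by rewrite /fsum !big_ord0 subr0 fcert0.
have := IH (ltnW lJ); rewrite /fsum !big_ord_recr /= => {}IH.
have h2 := @fterm_step w gw M J lJ.
have h1 := @fterm_step w^-1 (genericV gw) M J lJ.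
transitivity (fcert M J w + fcert M J w^-1 + (fcert M J.+1 w - fcert M J w) +
   (fcert M J.+1 w^-1 - fcert M J w^-1)); last by ring.
by rewrite -IH -h1 -h2; ring.
Qed.

Lemma gsum_step J M : (J <= M)%N ->
  gsum J M.+1 - gsum J M = gcert M J w + gcert M J w^-1.
Proof.
elim: J => [_|J IH lJ]; first by rewrite /gsum !big_ord0 !addr0 gterm_step0.
have := IH (ltnW lJ); rewrite /gsum !big_ord_recr /= => {}IH.
have h2 := gterm_step gw lJ; have h1 := gterm_step (genericV gw) lJ.
transitivity (gcert M J w + gcert M J w^-1 + (gcert M J.+1 w - gcert M J w) +
   (gcert M J.+1 w^-1 - gcert M J w^-1)); last by ring.
by rewrite -IH -h1 -h2; ring.
Qed.

(** Induction on [M]: the change of the old terms is a boundary term, which [fcert_edge] cancels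
    against the entering one. *)
Lemma fsum_full M : fsum M.+1 M = 1.
Proof.
elim: M => [|M IH].
  rewrite /fsum big_ord_recr big_ord0 /= add0r /fterm.
  rewrite po_numV po_denVl po_denVr' !subn0 !addn0 muln0 !(qbin0 gw).
  rewrite !(poS, po0).
  have := w21_neq0; have := qw2_neq0 gw 0; have := w_neq0 gw; have := q_neq0 gw.
  have := qw2_neq0 gw 1; have := w2_neq0 gw 1.
  rewrite !(exprS, exprD, expr0, mulr1) => *; field.
  by rewrite ?oner_neq0 ?andbT; do ?[apply/andP; split].
rewrite /fsum big_ord_recr /= -/(fsum M.+1 M.+1).
have /eqP := @fsum_step M.+1 M (leqnn _); rewrite subr_eq IH => /eqP ->.
rewrite !fcert_edge //; last exact: genericV.
by ring.
Qed.

Lemma gsum_full M : gsum M M = 1.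
Proof.
elim: M => [|M IH].
  rewrite /gsum big_ord0 addr0 /gterm.
  rewrite !subn0 !addn0 muln0 !(qbin0 gw) !(poS, po0).
  have := w21_neq0; have := qw2_neq0 gw 0; have := w_neq0 gw; have := q_neq0 gw.
  rewrite !(exprS, exprD, expr0, mulr1) => *; field.
  by rewrite ?oner_neq0 ?andbT; do ?[apply/andP; split].
rewrite /gsum big_ord_recr /= addrA -/(gsum M M.+1).
have /eqP := @gsum_step M M (leqnn _); rewrite subr_eq IH => /eqP ->.
rewrite !gcert_edge //; last exact: genericV.
by ring.
Qed.

End Symmetric.
End FiniteForms.

(** * The q-adic order of Laurent series and computation with monomials *)

Section Valuation.
Variable F : fieldType.
Local Notation L := (laurent F).
Implicit Types f g : L.

Definition vge (m : int) f := vanish_below (lcoef f) m.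

Lemma vgeW m n f : n <= m -> vge m f -> vge n f.
Proof. exact: vanish_belowW. Qed.

Lemma vge_ex f : exists m, vge m f. Proof. exact: lcoef_bounded. Qed.

Lemma vgeD m f g : vge m f -> vge m g -> vge m (f + g).
Proof. by move=> fm gm k km; rewrite /= fm // gm // addr0. Qed.

Lemma vgeN m f : vge m f -> vge m (- f).
Proof. by move=> fm k km; rewrite /= fm // oppr0. Qed.

Lemma vgeB m f g : vge m f -> vge m g -> vge m (f - g).
Proof. by move=> fm gm; apply/vgeD/vgeN. Qed.

Lemma vgeM m n f g : vge m f -> vge n g -> vge (m + n) (f * g).
Proof. exact: lconv_vanish. Qed.

Lemma vge_monom m : vge m (lmonom F m).
Proof. by move=> k km /=; rewrite lt_eqF. Qed.

Lemma vge1 : vge 0 (1 : L). Proof. exact: vge_monom. Qed.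

Lemma lcoef1 k : lcoef (1 : L) k = (k == 0)%:R. Proof. by []. Qed.

Lemma vgeX m n f : vge m f -> vge (m *+ n) (f ^+ n).
Proof.
move=> fm; elim: n => [|n IH]; first exact: vge1.
by rewrite exprS mulrS; apply: vgeM.
Qed.

Lemma lcoefM_lead m n f g : vge m f -> vge n g ->
  lcoef (f * g) (m + n) = lcoef f m * lcoef g n.
Proof.
move=> fm gn; have := lconvE 0 fm gn; rewrite addr0 => h; rewrite [LHS]h.
by rewrite /psmul big_ord_recl big_ord0 addr0 /ptail !addr0.
Qed.

Lemma lmonomD m n : lmonom F m * lmonom F n = lmonom F (m + n).
Proof.
have vm := @vge_monom m; have vn := @vge_monom n.
apply: laurentP; apply: (@eq_ptail _ _ _ (m + n)).
- exact: vgeM vm vn.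
- exact: vge_monom.
move=> k; rewrite [LHS](lconvE k vm vn) /psmul big_ord_recl big1 => [|i _].
  rewrite addr0 /ptail /= addr0 eqxx mul1r subn0.
  by congr ((_ : bool)%:R); lia.
rewrite /ptail /=; suff -> : (m + bump 0 i == m) = false by rewrite mul0r.
by rewrite /bump /=; lia.
Qed.

Lemma lmonomBr m n p : lmonom F m * (lmonom F n - lmonom F p) =
  lmonom F (m + n) - lmonom F (m + p).
Proof. by rewrite mulrBr !lmonomD. Qed.

Lemma lqXn n : (lq : L) ^+ n = lmonom F n.
Proof. by elim: n => // n IH; rewrite exprS IH lmonomD; congr lmonom; lia. Qed.

Lemma lmonomV m : (lmonom F m)^-1 = lmonom F (- m).
Proof.
have h : lmonom F m * lmonom F (- m) = 1 by rewrite lmonomD subrr.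
have m0 : lmonom F m != 0.
  by apply: contra_eq_neq h => ->; rewrite mul0r eq_sym oner_neq0.
by apply: (mulfI m0); rewrite divff.
Qed.

Lemma lqXz m : (lq : L) ^ m = lmonom F m.
Proof.
case: m => n; first by rewrite -exprnP lqXn.
by rewrite NegzE -exprnN lqXn lmonomV.
Qed.

Lemma valuation_ex f : f != 0 -> exists d, vge d f /\ lcoef f d != 0.
Proof.
move=> f0; have [m fm] := vge_ex f.
have exk : exists i : nat, lcoef f (m + i%:Z) != 0.
  apply: contrapT => /forallNP fN; case/eqP: f0; apply: laurentP.
  apply: (eq_ptail fm) => // i.
  by apply/eqP; have /negP := fN i; rewrite negbK.
case: (ex_minnP exk) => j fj jmin; exists (m + j%:Z); split=> // k kmj.
have [/fm //| mk] := ltP k m.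
apply/eqP; apply: contraTT kmj => fk; rewrite -leNgt.
have /jmin : lcoef f (m + `|k - m|%N%:Z) != 0.
  by have -> : m + `|k - m|%N%:Z = k by lia.
lia.
Qed.

(** The leading coefficients of [f] and [f^-1] multiply to a nonzero coefficient of 1, which forces
    their orders to be opposite. *)
Lemma vgeV d f : vge d f -> lcoef f d != 0 -> vge (- d) f^-1.
Proof.
move=> fd fd0; have f0 : f != 0 by apply: contraNneq fd0 => ->.
have [e [ge ge0]] : exists e, vge e f^-1 /\ lcoef f^-1 e != 0.
  by apply: valuation_ex; rewrite invr_eq0.
have := lcoefM_lead fd ge; rewrite divff // => h.
have : lcoef f d * lcoef f^-1 e != 0 by rewrite mulf_neq0.
rewrite -h lcoef1; have [de _|_] := eqVneq (d + e) 0.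
  by have <- : e = - d by lia.
by rewrite mulr0n eqxx.
Qed.

Lemma vge_monomW m n : m <= n -> vge m (lmonom F n).
Proof. by move=> mn; apply: vgeW mn (@vge_monom n). Qed.

Lemma vge_monomM m n : 1 <= m + n -> vge 1 (lmonom F m * lmonom F n).
Proof. by move=> h; rewrite lmonomD; apply: vge_monomW. Qed.

End Valuation.

(** * Limits in the q-adic topology *)

Section Convergence.
Variable F : fieldType.
Local Notation L := (laurent F).
Implicit Types (f g l m : L) (u v : nat -> L).

Lemma lcvgE u l : lcvg u l <->
  forall k, exists N, forall n, (N <= n)%N -> vge k (u n - l).
Proof.
split=> h k.
  have [N hN] := h k; exists N => n /hN un j jk.
  by rewrite /= un ?subrr // ltW.
have [N hN] := h (k + 1); exists N => n /hN un j jk.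
have h0 : lcoef (u n - l) j = 0 by apply: un; rewrite ltzD1.
by apply/eqP; rewrite -subr_eq0; apply/eqP; exact: h0.
Qed.

Lemma lcvg_unique u l m : lcvg u l -> lcvg u m -> l = m.
Proof.
move=> ul um; apply: laurentP => k; have [N hN] := ul k; have [N' hN'] := um k.
by rewrite -(hN (maxn N N')) ?leq_maxl // hN' ?leq_maxr.
Qed.

Lemma lcvg_cst f : lcvg (fun=> f) f.
Proof. by move=> k; exists 0%N. Qed.

Lemma lcvgD u v l m : lcvg u l -> lcvg v m -> lcvg (fun n => u n + v n) (l + m).
Proof.
move=> ul vm k; have [N hN] := ul k; have [N' hN'] := vm k.
exists (maxn N N') => n; rewrite geq_max => /andP[n1 n2] j jk /=.
by rewrite hN // hN'.
Qed.

Lemma lcvgN u l : lcvg u l -> lcvg (fun n => - u n) (- l).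
Proof. by move=> h k; have [N hN] := h k; exists N => n /hN un j jk /=; rewrite un. Qed.

Lemma lcvgM u v l m : lcvg u l -> lcvg v m -> lcvg (fun n => u n * v n) (l * m).
Proof.
move=> /lcvgE ul /lcvgE vm; apply/lcvgE => k.
have [a la] := vge_ex l; have [b mb] := vge_ex m.
have [N hN] := ul (k - b); have [N1 hN1] := vm (k - a); have [N2 hN2] := vm b.
exists (maxn N (maxn N1 N2)) => n; rewrite !geq_max => /and3P[n0 n1 n2].
have -> : u n * v n - l * m = (u n - l) * ((v n - m) + m) + l * (v n - m) by ring.
apply: vgeD.
  have -> : k = (k - b) + b by lia.
  by apply: vgeM; [exact: hN | apply: vgeD => //; exact: hN2].
have -> : k = a + (k - a) by lia.
by apply: vgeM => //; exact: hN1.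
Qed.

Lemma lcvgV u l : l != 0 -> lcvg u l -> lcvg (fun n => (u n)^-1) l^-1.
Proof.
move=> l0 ul; have [d [ld ld0]] := valuation_ex l0.
have [N1 hN1] := ul d; move/lcvgE: ul => ul; apply/lcvgE => k.
have [N2 hN2] := ul (k + d + d).
exists (maxn N1 N2) => n; rewrite geq_max => /andP[n1 n2].
have und : lcoef (u n) d != 0 by rewrite hN1.
have un : vge d (u n) by move=> j jd; rewrite hN1 ?ld // ltW.
have un0 : u n != 0 by apply: contraNneq und => ->.
have -> : (u n)^-1 - l^-1 = (- (u n - l)) * ((u n)^-1 * l^-1).
  by field; rewrite un0 l0.
have -> : k = (k + d + d) + (- d + - d) by lia.
by apply: vgeM; [exact/vgeN/hN2 | apply: vgeM; apply: vgeV].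
Qed.

Lemma lcvg_comp u l (phi : nat -> nat) :
  (forall N, exists n0, forall n, (n0 <= n)%N -> (N <= phi n)%N) ->
  lcvg u l -> lcvg (u \o phi) l.
Proof.
move=> hphi ul k; have [N hN] := ul k; have [n0 h0] := hphi N.
by exists n0 => n /h0 /hN.
Qed.

Lemma lcvg_sum (U : nat -> nat -> L) (V : nat -> L) n :
  (forall i, (i < n)%N -> lcvg (U i) (V i)) ->
  lcvg (fun k => \sum_(i < n) U i k) (\sum_(i < n) V i).
Proof.
elim: n => [|n IH] h.
  by rewrite big_ord0 => k; exists 0%N => m _ j _; rewrite big_ord0.
rewrite big_ord_recr; move=> k.
have [N hN] := lcvgD (IH (fun i lt => h i (ltnW lt))) (h n (ltnSn n)) k.
by exists N => m /hN hm j jk; rewrite big_ord_recr hm.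
Qed.

(** * Infinite products as limits of finite ones *)

Section QPochhammer.
Variable y : L.
Hypothesis y1 : vge 1 y.

Lemma po_vge x n : vge 1 x -> vge 1 (po y x n - 1).
Proof.
move=> x1; elim: n => [|n IH]; first by rewrite po0 subrr.
have h : vge 1 (x * y ^+ n).
  by apply: vgeW _ (vgeM x1 (@vgeX _ _ n _ y1)); lia.
have -> : po y x n.+1 - 1 = (po y x n - 1) - ((po y x n - 1) * (x * y ^+ n) + x * y ^+ n).
  by rewrite poS; ring.
apply: vgeB => //; apply: vgeD => //.
by apply: (@vgeW _ (1 + 1)) => //; apply: vgeM.
Qed.

Lemma po_cvg1 x : vge 1 x -> exists l, lcvg (po y x) l.
Proof.
move=> x1.
have po_vge0 n : vge 0 (po y x n).
  rewrite -(subrK 1 (po y x n)); apply: vgeD; last exact: vge1.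
  by apply: vgeW _ (po_vge n x1).
have stab n : vge n.+1 (po y x n.+1 - po y x n).
  have -> : po y x n.+1 - po y x n = - (po y x n * (x * y ^+ n)) by rewrite poS; ring.
  apply: vgeN; 
  by apply: vgeW _ (vgeM (po_vge0 n) (vgeM x1 (@vgeX _ _ n _ y1))); lia.
have stabD n d : vge n.+1 (po y x (n + d)%N - po y x n).
  elim: d => [|d IH]; first by rewrite addn0 subrr.
  rewrite addnS -(subrK (po y x (n + d)) (po y x (n + d).+1)) -addrA.
  by apply: vgeD => //; apply: vgeW _ (stab _); lia.
(* Lengthening a product of length n changes no coefficient of degree at most n, so the coefficient
   of degree k >= 0 is final at length k. *)
pose c (k : int) := lcoef (po y x `|k|%N) k.
have c0 : vanish_below c 0 by move=> k k0; rewrite /c po_vge0.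
exists (Laurent (ex_intro _ _ c0)) => k; exists `|k|%N => n kn j jk /=.
have [j0|j0] := ltP j 0; first by rewrite c0 // po_vge0.
have jn : (`|j| <= n)%N by lia.
have h0 : lcoef (po y x (`|j| + (n - `|j|))%N - po y x `|j|%N) j = 0.
  by apply: stabD; lia.
apply/eqP; rewrite /c -subr_eq0 -[in po y x n](subnKC jn); apply/eqP; exact: h0.
Qed.

(** Only [x * y] must have positive order, which admits x = q^(-S): the factor [1 - x] is split off
    and [po_cvg1] is applied to [x * y]. *)
Lemma po_cvg x : vge 1 (x * y) -> lcvg (po y x) (qpoch x y).
Proof.
move=> xy; have [l hl] := po_cvg1 xy.
suff : exists l, lcvg (po y x) l by exact: xgetPex.
exists ((1 - x) * l) => k; have [N hN] := lcvgM (lcvg_cst (1 - x)) hl k.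
by exists N.+1 => -[//|n] Nn j jk; rewrite poSl hN.
Qed.

Lemma qpochS x : vge 1 (x * y) -> qpoch x y = (1 - x) * qpoch (x * y) y.
Proof.
move=> xy; apply: lcvg_unique (po_cvg xy) _.
have xyy : vge 1 (x * y * y).
  by apply: (@vgeW _ (1 + 1)) => //; apply: vgeM.
move=> k; have [N hN] := lcvgM (lcvg_cst (1 - x)) (po_cvg xyy) k.
by exists N.+1 => -[//|n] Nn j jk; rewrite poSl hN.
Qed.

Lemma qpoch_neq0 x : x != 1 -> vge 1 (x * y) -> qpoch x y != 0.
Proof.
move=> x1 xy; rewrite qpochS // mulf_neq0 //; first by rewrite subr_eq0 eq_sym.
have xyy : vge 1 (x * y * y).
  by apply: (@vgeW _ (1 + 1)) => //; apply: vgeM.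
have [N hN] := po_cvg xyy 0; apply/eqP => q0.
have := hN N (leqnn _) 0 (lexx _); rewrite q0 /=.
have : lcoef (po y (x * y) N - 1) 0 = 0 by apply: po_vge.
move=> /= /eqP; rewrite subr_eq0 => /eqP -> /eqP.
by rewrite oner_eq0.
Qed.

End QPochhammer.
(** The factors of even and of odd index are collected separately. *)
Lemma qpoch_split x (y : L) : vge 1 y -> vge 1 (x * y) ->
  qpoch x y = qpoch x (y ^+ 2) * qpoch (x * y) (y ^+ 2).
Proof.
move=> y1 xy; have y2 : vge 1 (y ^+ 2) by apply: (@vgeW F (1 *+ 2)) (vgeX y1).
have E n : po y x n.*2 = po (y ^+ 2) x n * po (y ^+ 2) (x * y) n.
  elim: n => [|n IH]; first by rewrite !po0 mulr1.
  rewrite doubleS !poS IH -exprM mul2n -[x * y * _]mulrA -exprS.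
  by rewrite mulrACA mulrA.
apply: (@lcvg_unique (fun n => po y x n.*2)).
  by apply: (lcvg_comp _ (po_cvg y1 xy)) => k; exists k => n; lia.
have -> : (fun n => po y x n.*2) =
  fun n => po (y ^+ 2) x n * po (y ^+ 2) (x * y) n by apply/funext.
apply: lcvgM; apply: po_cvg => //.
  by rewrite exprS mulrA expr1; apply: (@vgeW F (1 + 1)) (vgeM xy y1).
by apply: (@vgeW F (1 + (1 *+ 2))) (vgeM xy (vgeX y1)).
Qed.

Lemma qpoch_sqr x (y : L) : vge 1 y -> vge 1 (x * y) ->
  qpoch (x ^+ 2) (y ^+ 2) = qpoch x y * qpoch (- x) y.
Proof.
move=> y1 xy; have y2 : vge 1 (y ^+ 2) by apply: (@vgeW F (1 *+ 2)) (vgeX y1).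
apply: (@lcvg_unique (po (y ^+ 2) (x ^+ 2))).
  apply: po_cvg => //; rewrite -exprMn.
  by apply: (@vgeW F (1 *+ 2)) (vgeX xy).
have -> : po (y ^+ 2) (x ^+ 2) = fun n => po y x n * po y (- x) n.
  apply/funext => n; rewrite /po -big_split; apply: eq_bigr => i _ /=.
  by rewrite -exprM mulnC exprM -exprMn; ring.
apply: lcvgM; apply: po_cvg => //.
by rewrite mulNr; apply: vgeN.
Qed.

End Convergence.

(** * Laurent series with nonnegative coefficients *)

Section Positivity.
Variable F : numFieldType.
Local Notation L := (laurent F).
Implicit Types f g : L.

Definition lpos f := forall k, 0 <= lcoef f k.

Lemma lpos0 : lpos (0 : L). Proof. by []. Qed.

Lemma lpos_monom m : lpos (lmonom F m).
Proof. by move=> k /=; rewrite ler0n. Qed.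

Lemma lpos1 : lpos (1 : L). Proof. exact: lpos_monom. Qed.

Lemma lposD f g : lpos f -> lpos g -> lpos (f + g).
Proof. by move=> hf hg k; apply: addr_ge0. Qed.

Lemma lposM f g : lpos f -> lpos g -> lpos (f * g).
Proof.
move=> hf hg k; have [m fm] := vge_ex f; have [n gn] := vge_ex g.
have [kmn|mnk] := ltP k (m + n); first by rewrite (vgeM fm gn).
have -> : k = m + n + (absz (k - (m + n)%R)%R)%:Z by lia.
rewrite [lcoef _ _](@lconvE _ _ _ _ _ _ fm gn).
by apply: sumr_ge0 => i _; apply: mulr_ge0; [apply: hf | apply: hg].
Qed.

Lemma lposX f n : lpos f -> lpos (f ^+ n).
Proof.
by move=> hf; elim: n => [|n IH]; rewrite ?exprS; [exact: lpos1|apply: lposM].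
Qed.

Lemma lpos_sum n (f : nat -> L) : (forall i, (i < n)%N -> lpos (f i)) ->
  lpos (\sum_(i < n) f i).
Proof.
elim: n => [|n IH] h; first by rewrite big_ord0; apply: lpos0.
by rewrite big_ord_recr; apply: lposD; [apply: IH => i /ltnW/h | apply: h].
Qed.

Lemma lpos_prod n (f : nat -> L) : (forall i, (i < n)%N -> lpos (f i)) ->
  lpos (\prod_(i < n) f i).
Proof.
elim: n => [|n IH] h; first by rewrite big_ord0; apply: lpos1.
by rewrite big_ord_recr; apply: lposM; [apply: IH => i /ltnW/h | apply: h].
Qed.

Lemma lpos_lim u f : (forall n, lpos (u n)) -> lcvg u f -> lpos f.
Proof. by move=> hu uf k; have [N hN] := uf k; rewrite -(hN N (leqnn _) k (lexx _)); apply: hu. Qed.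

(* Unrolling the recursion writes [B'] as a sum of nonnegative series
   [c ^+ i * B (2 * i)] and a remainder of arbitrarily high order. *)
Lemma lpos_rec (B B' : nat -> L) c :
  (forall p, B' p = B p + c * B' p.+2) -> lpos c -> (forall p, lpos (B p)) ->
  (forall p k, exists I, vge k (c ^+ I * B' (p + I.*2)%N)) ->
  forall p, lpos (B' p).
Proof.
move=> rec cpos Bpos small p k; have [I hI] := small p (k + 1).
have E J : B' p = \sum_(i < J) c ^+ i * B (p + i.*2)%N + c ^+ J * B' (p + J.*2)%N.
  elim: J => [|J IH]; first by rewrite big_ord0 add0r mul1r addn0.
  rewrite IH [B' (p + J.*2)%N]rec big_ord_recr /= doubleS !addnS mulrDr addrA.
  by rewrite mulrA -exprSr.
rewrite (E I) /= [X in _ + X]hI ?addr0; last lia.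
apply: (@lpos_sum I (fun i => c ^+ i * B (p + i.*2)%N)) => i _.
by apply: lposM => //; apply: lposX.
Qed.

Lemma lmonomX m n : lmonom F m ^+ n = lmonom F (m * n%:Z).
Proof.
elim: n => [|n IH]; first by rewrite mulr0.
by rewrite exprS IH lmonomD; congr lmonom; lia.
Qed.

Lemma lmonomXV m n : lmonom F m ^- n = lmonom F (- (m * n%:Z)).
Proof. by rewrite lmonomX lmonomV. Qed.

Lemma lmonom_neq0 m : lmonom F m != 0.
Proof.
by apply/eqP => /(congr1 (@lcoef F ^~ m))/eqP; rewrite /= eqxx oner_eq0.
Qed.

Lemma lmonom_neq1 m : m != 0 -> lmonom F m != 1.
Proof.
move=> m0; apply/eqP => /(congr1 (@lcoef F ^~ m))/eqP.
by rewrite /= eqxx (negbTE m0) oner_eq0.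
Qed.

Lemma monom1_neq0 e : 0 < e -> 1 - lmonom F e != 0.
Proof.
move=> e0; apply/eqP => /(congr1 (@lcoef F ^~ 0))/eqP.
by rewrite /= (lt_eqF e0) subr0 oner_eq0.
Qed.

Lemma lpos_geom e : 0 < e -> lpos (1 - lmonom F e)^-1.
Proof.
move=> e0; have u0 := monom1_neq0 e0.
have [a ha] := vge_ex (1 - lmonom F e)^-1.
(* Constant sequences suffice here, with the recursion 1/(1 - u) = 1 + u/(1 - u) for u = q^e. *)
apply: (@lpos_rec (fun=> 1) (fun=> (1 - lmonom F e)^-1) (lmonom F e) _ _ _ _ 0).
- by move=> _; field.
- exact: lpos_monom.
- by move=> _; apply: lpos1.
move=> _ k; exists (absz (k - a)%R); have := vgeM (@vgeX _ _ (absz (k - a)%R) _ (@vge_monom F e)) ha; apply: vgeW.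
have : ((absz (k - a)%R) : int) <= e *+ (absz (k - a)%R).
  by rewrite -mulr_natr; nia.
lia.
Qed.

Lemma lpos_shift_lim (u : nat -> L) l N :
  (forall M, (N < M)%N -> lpos (u M)) -> lcvg u l -> lpos l.
Proof.
move=> h ul; apply: (@lpos_lim (u \o addn N.+1)).
  by move=> n; apply: h; rewrite leq_addr.
by apply: lcvg_comp ul => k; exists k => n; lia.
Qed.

Lemma lpos_poV (l m : int) n : 0 <= l -> 0 < m ->
  lpos (po (lmonom F l) (lmonom F m) n)^-1.
Proof.
move=> l0 m0; rewrite /po -prodfV.
apply: (@lpos_prod _ (fun i => (1 - lmonom F m * lmonom F l ^+ i)^-1)) => i _.
by rewrite lmonomX lmonomD; apply: lpos_geom; nia.
Qed.

End Positivity.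

(** * Nonnegativity of symmetrized building blocks at z = q^s *)

Section Symmetrized.
Variables (F : numFieldType) (r s : nat).
Hypotheses (s0 : (0 < s)%N) (sr : (2 * s < r)%N).
Local Notation L := (laurent F).
Local Notation Q := (lmonom F r).
Local Notation z := (lmonom F s).

Definition sympos (G : L -> L) := lpos (G z + G z^-1).

Lemma symposD G H : sympos G -> sympos H -> sympos (fun w => G w + H w).
Proof. by move=> hG hH; rewrite /sympos addrACA; apply: lposD. Qed.

Lemma symposM (c : L) G : lpos c -> sympos G -> sympos (fun w => c * G w).
Proof. by move=> hc hG; rewrite /sympos -mulrDr; apply: lposM. Qed.

Lemma generic_z : generic Q z.
Proof.
split.
- exact: lmonom_neq0.
- exact: lmonom_neq0.
- by move=> i; rewrite lmonomX lmonom_neq1 //; nia.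
- by move=> i; rewrite !lmonomX lmonomD lmonom_neq1 //; nia.
- move=> i; rewrite !lmonomX lmonomV lmonomD lmonom_neq1 //.
  by case: i => [|i]; [lia | have : (r <= r * i.+1)%N by rewrite leq_pmulr]; lia.
Qed.

(** Induction on [n]. Without denominator factors this is the geometric sum of [geom_symmetric]; a
    new factor is unrolled by [core_rec], whose coefficient does not change when [z] is inverted. *)
Lemma sympos_core e n p : (0 < e)%N -> sympos (core Q e n p).
Proof.
move=> e0; elim: n p => [|n IH] p.
  rewrite /sympos /core !po0 !mulr1 exprVn invrK.
  have gz := generic_z.
  rewrite (geom_symmetric gz).
  apply: lposM; first by rewrite lmonomX lmonomV; apply: lpos_monom.
  by apply: (@lpos_sum _ _ (fun i => z ^+ i)) => i _; apply/lposX/lpos_monom.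
have gz := generic_z; have gV := genericV gz.
apply: (@lpos_rec _ (fun p => core Q e n p z + core Q e n p z^-1)
   (fun p => core Q e n.+1 p z + core Q e n.+1 p z^-1) (Q ^+ (e + n))).
- move=> {}p; cbv beta.
  by rewrite (core_rec gz) (core_rec gV) mulrDr addrACA.
- exact/lposX/lpos_monom.
- exact: IH.
move=> {}p k.
(* [D1] and [D2] do not depend on the index [p], so the order of the remainder is controlled by
   explicit monomials. *)
pose D1 := ((1 - z) * po Q (Q ^+ e / z ^+ 2) n.+1)^-1.
pose D2 := ((1 - z^-1) * po Q (Q ^+ e / z^-1 ^+ 2) n.+1)^-1.
have E1 j : core Q e n.+1 j z = lmonom F (- (s%:Z * j%:Z)) * D1.
  by rewrite -lmonomXV.
have E2 j : core Q e n.+1 j z^-1 = lmonom F (s%:Z * j%:Z) * D2.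
  have e2 : z^-1 ^- j = z ^+ j by rewrite exprVn invrK.
  by rewrite -lmonomX /core e2.
move: D1 D2 E1 E2 => D1 D2 E1 E2.
have [a ha] := vge_ex D1; have [b hb] := vge_ex D2.
(* Each unrolling gains r(e+n) >= r > 2s in order and loses at most 2s, a net gain of at least 1.
   The other summands of [I] absorb the initial losses. *)
pose I := (`|k| + `|a| + `|b| + s * p)%N; exists I.
have hI : (s * (p + I.*2) + I <= r * (e + n) * I + s * p)%N.
  have : (r * I <= r * (e + n) * I)%N by rewrite leq_mul2r leq_pmulr ?orbT //; lia.
  have : ((2 * s).+1 * I <= r * I)%N by rewrite leq_mul2r sr orbT.
  by rewrite -!muln2; nia.
rewrite E1 E2 mulrDr !mulrA !lmonomX !lmonomD.
apply: vgeD.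
  have := vgeM (@vge_monom F (r%:Z * (e + n)%:Z * I%:Z - s%:Z * (p + I.*2)%:Z)) ha.
  apply: vgeW; rewrite -!PoszM.
  by move: hI; rewrite /I; lia.
have := vgeM (@vge_monom F (r%:Z * (e + n)%:Z * I%:Z + s%:Z * (p + I.*2)%:Z)) hb.
apply: vgeW; rewrite -!PoszM.
by move: hI; rewrite /I; lia.
Qed.
End Symmetrized.

(** * Signs of the truncated finite forms *)

Section Truncation.
Variables (F : numFieldType) (r s : nat).
Hypotheses (s0 : (0 < s)%N) (sr : (2 * s < r)%N).
Local Notation L := (laurent F).
Local Notation Q := (lmonom F r).
Local Notation z := (lmonom F s).
Local Notation gz := (generic_z F s0 sr).

Lemma lpos_poN m n : lpos (po Q (- lmonom F m) n).
Proof.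
apply: (@lpos_prod _ _ (fun i => 1 - - lmonom F m * Q ^+ i)) => i _.
rewrite mulNr opprK lmonomX lmonomD.
by apply: lposD; [apply: lpos1 | apply: lpos_monom].
Qed.

Lemma lpos_qbin n m : lpos (qbin Q n m).
Proof.
elim: n m => [|n IHn] m; first by rewrite (qbin0l gz); apply: lpos1.
elim: m => [|m IHm]; first by rewrite (qbin0 gz); apply: lpos1.
rewrite (qbinS gz); apply: lposD => //; apply: lposM => //.
exact/lposX/lpos_monom.
Qed.

(** At z = q^s the denominator factors are 1 - q^m with m > 0, because r - 2s > 0; the numerator
    factors are 1 + q^m. *)
Lemma lpos_weight M d : lpos (weight Q M d z).
Proof.
rewrite /weight lmonomV lmonomXV lmonomX !lmonomD invfM.
by repeat apply: lposM; try (by apply: lpos_poN); apply: lpos_poV; lia.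
Qed.

Lemma lpos_pair_factor d : lpos (pair_factor Q d z).
Proof.
rewrite /pair_factor lmonomXV !lmonomX !lmonomD invfM.
by apply: lposM; apply: lpos_geom; lia.
Qed.

Lemma lpos_Q n : lpos (Q ^+ n).
Proof. exact/lposX/lpos_monom. Qed.

Lemma lpos_QV n : lpos (Q ^- n).
Proof. by rewrite lmonomXV; apply: lpos_monom. Qed.

(** Here [c] collects the factors that take the same value at [z] and [z^-1], so that symmetrization
    only concerns [H]. *)
Lemma lpos_sym_const (c : L) G H : lpos c -> sympos s H ->
  G z = c * H z -> G z^-1 = c * H z^-1 -> lpos (G z + G z^-1).
Proof. by move=> hc hH -> ->; apply: symposM. Qed.

Lemma sympos_fcert N M : (N < M)%N -> sympos s (fun w => - fcert Q M N.+1 w).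
Proof.
move=> NM; have [d ->] : exists d, M = (N.+1 + d)%N by exists (M - N.+1)%N; lia.
have gV := genericV gz.
set M' := (N.+1 + d)%N.
pose H w := qbin Q (M' + N.+1) d.+1 * Q ^- N.+1
          * (core Q d.+1 (2 * N).+3 (3 * N + 3) w
             + Q ^+ N.+1 * core Q d.+1 (2 * N).+3 (3 * N + 4) w)
        + qbin Q (M'.+1 + N.+1) d.+1 * pair_factor Q d z
          * (core Q d.+2 (2 * N).+2 (3 * N + 2) w
             + Q ^- N.+1 * core Q d.+2 (2 * N).+2 (3 * N).+1 w
             + Q ^+ M'.+1 * core Q d.+2 (2 * N).+2 (3 * N + 3) w
             + Q ^- N.+1 * Q ^+ M'.+1 * core Q d.+2 (2 * N).+2 (3 * N + 2) w).
have hH : sympos s H.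
  apply: symposD; apply: symposM.
  - exact: lposM (lpos_qbin _ _) (lpos_QV _).
  - apply: symposD; last apply: symposM; try exact: sympos_core; exact: lpos_Q.
  - exact: lposM (lpos_qbin _ _) (lpos_pair_factor _).
  - apply: symposD; [apply: symposD; [apply: symposD|] |].
    + exact: sympos_core.
    + by apply: symposM; [exact: lpos_QV | exact: sympos_core].
    + by apply: symposM; [exact: lpos_Q | exact: sympos_core].
    + apply: symposM; [exact: lposM (lpos_QV _) (lpos_Q _) | exact: sympos_core].
apply: (@lpos_sym_const (weight Q M' d z * Q ^+ (pent N.+1 + M'.+1)) _ H) => //.
- exact: lposM (lpos_weight _ _) (lpos_Q _).
- by rewrite (fcert_core gz) opprK.
- by rewrite (fcert_core gV) opprK weightV pair_factorV.
Qed.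

Lemma sympos_gcert N M : (N < M)%N -> sympos s (gcert Q M N).
Proof.
move=> NM; have [d ->] : exists d, M = (N.+1 + d)%N by exists (M - N.+1)%N; lia.
have gV := genericV gz.
set M' := (N.+1 + d)%N.
pose H w := qbin Q (M' + N) d.+1 * core Q d.+1 (2 * N).+2 (3 * N + 2) w
     + qbin Q (M' + N).+1 d.+1 * pair_factor Q d z
       * (core Q d.+2 (2 * N).+1 (3 * N) w
          + Q ^+ M'.+1 * core Q d.+2 (2 * N).+1 (3 * N).+1 w).
have hH : sympos s H.
  apply: symposD; apply: symposM.
  - exact: lpos_qbin.
  - exact: sympos_core.
  - exact: lposM (lpos_qbin _ _) (lpos_pair_factor _).
  - apply: symposD; last apply: symposM; try exact: sympos_core; exact: lpos_Q.
apply: (@lpos_sym_const (weight Q M' d z * Q ^+ (pent N + N + M'.+1)) _ H) => //.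
- exact: lposM (lpos_weight _ _) (lpos_Q _).
- by rewrite (gcert_core gz).
- by rewrite (gcert_core gV) weightV pair_factorV.
Qed.

Lemma sympos_fterm_diag J : sympos s (fterm Q J J).
Proof.
have gV := genericV gz.
apply: (@lpos_sym_const (weight Q J 0 z * Q ^+ pent J) _
  (core Q 1 (2 * J) (3 * J))).
- exact: lposM (lpos_weight _ _) (lpos_Q _).
- exact: sympos_core.
- by rewrite (fterm_diag gz).
- by rewrite (fterm_diag gV) weightV.
Qed.

Lemma sympos_gterm_diag i : sympos s (fun w => - gterm Q i.+1 i.+1 w).
Proof.
have gV := genericV gz.
apply: (@lpos_sym_const (weight Q i 0 z * (Q ^+ pent i.+1 * Q ^- i.+1)) _
  (fun w => core Q 1 (2 * i).+1 (3 * i + 2) w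
        + Q ^+ i.+1 * core Q 1 (2 * i).+1 (3 * i).+1 w)).
- exact: lposM (lpos_weight _ _) (lposM (lpos_Q _) (lpos_QV _)).
- apply: symposD; last apply: symposM; try exact: sympos_core; exact: lpos_Q.
- by rewrite (gterm_diag gz) opprK.
- by rewrite (gterm_diag gV) opprK weightV.
Qed.

(** At [M = N.+1] the full sum is 1, so the difference is the symmetrized last term. Each further
    step adds the symmetrized [- fcert]. *)
Lemma lpos_fsum N M : (N < M)%N -> lpos (1 - fsum Q z N.+1 M).
Proof.
elim: M => // M IH; rewrite ltnS leq_eqVlt => /predU1P[->|NM].
  have := fsum_full gz M.+1; rewrite {1}/fsum big_ord_recr /= -/(fsum _ _ _ _).
  move=> E; rewrite -[X in lpos (X - _)]E (addrC (fsum _ _ _ _)) addrK.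
  exact: sympos_fterm_diag.
have /eqP := fsum_step gz (leqW NM); rewrite subr_eq => /eqP ->.
by rewrite opprD addrCA opprD addrC; apply: lposD; [apply: IH | apply: sympos_fcert].
Qed.

(** As for [lpos_fsum], with opposite signs: the missing last pair is nonpositive and the boundary
    terms are nonnegative. *)
Lemma lpos_gsum N M : (N < M)%N -> lpos (gsum Q z N M - 1).
Proof.
elim: M => // M IH; rewrite ltnS leq_eqVlt => /predU1P[->|NM].
  have := gsum_full gz M.+1; rewrite {1}/gsum big_ord_recr /= addrA -/(gsum _ _ _ _).
  move=> E; rewrite -[X in lpos (_ - X)]E opprD addNKr opprD.
  exact: sympos_gterm_diag.
have /eqP := gsum_step gz (ltnW NM); rewrite subr_eq => /eqP ->.
by rewrite -addrA; apply: lposD; [apply: sympos_gcert | apply: IH].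
Qed.

End Truncation.

(** * Passage to the limit M -> oo *)

Lemma prefactor_inv (K : fieldType) (x a b c d e : K) :
  x != 0 -> 1 - x ^+ 2 != 0 ->
  e^-1 * ((1 + x^-1) * b * a) / ((1 - x ^- 2) * d * c) =
  - x * (e^-1 * ((1 + x) * a * b) / ((1 - x ^+ 2) * c * d)).
Proof.
move=> x0 x1; have x1' : x ^+ 2 - 1 != 0 by rewrite -opprB oppr_eq0.
rewrite !invfM; move: e^-1 c^-1 d^-1 => e' c' d'.
by move: x1 x1'; rewrite !expr2 => *; field; rewrite ?x0; do ?[apply/andP; split].
Qed.

Section Limits.
Variables (F : numFieldType) (r s : nat).
Hypotheses (s0 : (0 < s)%N) (sr : (2 * s < r)%N).
Local Notation L := (laurent F).
Local Notation Q := (lmonom F r).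
Local Notation z := (lmonom F s).
Local Notation gz := (generic_z F s0 sr).

Lemma vgeQ : vge 1 Q. Proof. by apply: vge_monomW; lia. Qed.

(** The factor [P] of the series, kept as a function because the symmetrized terms also involve its
    value at [z^-1]. *)
Definition prefactor (x : L) : L := (qpoch Q Q)^-1 *
  (qpoch (- x) Q * qpoch (- (Q / x)) Q) / (qpoch (x ^+ 2) Q * qpoch (Q / x ^+ 2) Q).

Section Term.
Variables (w : L).
Hypotheses (gw : generic Q w) (w1 : vge 1 (w * Q)) (w2 : vge 1 (w ^+ 2 * Q)).
Hypotheses (wV1 : vge 1 (Q / w * Q)) (wV2 : vge 1 (Q / w ^+ 2 * Q)).

Lemma lcvg_po x (phi : nat -> nat) : vge 1 (x * Q) ->
  (forall N, exists n0, forall n, (n0 <= n)%N -> (N <= phi n)%N) ->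
  lcvg (fun M => po Q x (phi M)) (qpoch x Q).
Proof. by move=> hx hphi; apply: (lcvg_comp hphi); apply: (po_cvg vgeQ). Qed.

Lemma qpochQ_neq0 : qpoch Q Q != 0.
Proof.
apply: (qpoch_neq0 vgeQ); first by rewrite lmonom_neq1 //; lia.
by rewrite lmonomD; apply: vge_monomW; lia.
Qed.

(** All three products in a q-binomial coefficient tend to (Q; Q)_oo, which leaves one inverse. *)
Lemma lcvg_qbin (phi psi : nat -> nat) :
  (forall N, exists n0, forall n, (n0 <= n)%N -> (N <= phi n)%N) ->
  (forall N, exists n0, forall n, (n0 <= n)%N -> (N <= psi n)%N) ->
  lcvg (fun M => qbin Q (phi M) (psi M)) (qpoch Q Q)^-1.
Proof.
move=> hphi hpsi; have QQ : vge 1 (Q * Q).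
  by rewrite lmonomD; apply: vge_monomW; lia.
have q0 := qpochQ_neq0.
have -> : (qpoch Q Q)^-1 = qpoch Q Q / (qpoch Q Q * qpoch Q Q).
  by rewrite invfM mulrA divff // mul1r.
apply: lcvgM; first apply: (@lcvg_po _ (fun M => phi M + psi M)%N) => //.
  by move=> N; have [n hn] := hphi N; exists n => k /hn; lia.
apply: lcvgV; first by rewrite mulf_neq0.
by apply: lcvgM; apply: lcvg_po.
Qed.

Lemma lcvg_num : lcvg (fun M => po Q (- w) M.+1 * po Q (- (Q / w)) M)
  (qpoch (- w) Q * qpoch (- (Q / w)) Q).
Proof.
apply: lcvgM.
  apply: (@lcvg_po _ S); first by rewrite mulNr; apply: vgeN.
  by move=> N; exists N => n; lia.
apply: (@lcvg_po _ id); first by rewrite mulNr; apply: vgeN.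
by move=> N; exists N.
Qed.

Lemma lcvg_den (phi psi : nat -> nat) :
  (forall N, exists n0, forall n, (n0 <= n)%N -> (N <= phi n)%N) ->
  (forall N, exists n0, forall n, (n0 <= n)%N -> (N <= psi n)%N) ->
  lcvg (fun M => (po Q (w ^+ 2) (phi M) * po Q (Q / w ^+ 2) (psi M))^-1)
    (qpoch (w ^+ 2) Q * qpoch (Q / w ^+ 2) Q)^-1.
Proof.
case: gw => _ _ _ h1 h2 hphi hpsi.
apply: lcvgV; last by apply: lcvgM; apply: lcvg_po.
rewrite mulf_neq0 // (qpoch_neq0 vgeQ) //; first by have := h1 0%N; rewrite mulr1.
by have := h2 1%N; rewrite mulrC.
Qed.

Lemma prefactorE (a b : L) : prefactor w * (a * b) =
  (qpoch Q Q)^-1 * a * b * (qpoch (- w) Q * qpoch (- (Q / w)) Q)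
    / (qpoch (w ^+ 2) Q * qpoch (Q / w ^+ 2) Q).
Proof. by rewrite /prefactor !(mulrAC _ _ (a * b)) (mulrA _ a b). Qed.

Lemma lcvg_fterm j : lcvg (fun M => fterm Q M j w)
  (prefactor w * (Q ^+ pent j * w ^- (3 * j) * (1 - Q ^+ (2 * j).+1 / w ^+ 2))).
Proof.
rewrite prefactorE.
apply: lcvgM; [apply: lcvgM; [apply: lcvgM; [apply: lcvgM|]|]|].
- by apply: lcvg_qbin => N; exists (N + j)%N => n; lia.
- exact: lcvg_cst.
- exact: lcvg_cst.
- exact: lcvg_num.
- by apply: lcvg_den => N; exists (N + j)%N => n; lia.
Qed.

Lemma lcvg_gterm j : lcvg (fun M => gterm Q M j w)
  (prefactor w * (Q ^+ pent j * w ^- (3 * j) * (1 - w / Q ^+ j))).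
Proof.
rewrite prefactorE.
apply: lcvgM; [apply: lcvgM; [apply: lcvgM; [apply: lcvgM|]|]|].
- by apply: lcvg_qbin => N; exists (N + j)%N => n; lia.
- exact: lcvg_cst.
- exact: lcvg_cst.
- exact: lcvg_num.
- by apply: lcvg_den => N; exists (N + j)%N => n; lia.
Qed.
End Term.

Lemma zVE : z^-1 = lmonom F (- s%:Z). Proof. exact: lmonomV. Qed.

(** Splitting off first factors leaves products that inversion only permutes, and (1 + 1/z)/(1 -
    1/z^2) = -z (1 + z)/(1 - z^2). *)
Lemma prefactorV : prefactor z^-1 = - z * prefactor z.
Proof.
rewrite /prefactor invrK exprVn invrK.
rewrite (@qpochS _ _ vgeQ (- z^-1)); last first.
  by rewrite zVE mulNr; apply/vgeN/vge_monomM; lia.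
rewrite (@qpochS _ _ vgeQ (- z)); last first.
  by rewrite mulNr; apply/vgeN/vge_monomM; lia.
rewrite (@qpochS _ _ vgeQ (z ^+ 2)); last first.
  by rewrite lmonomX; apply/vge_monomM; lia.
rewrite (@qpochS _ _ vgeQ (z ^- 2)); last first.
  by rewrite lmonomXV; apply/vge_monomM; lia.
rewrite !opprK (mulNr z^-1 Q) (mulNr z Q) (mulrC Q z) (mulrC Q z^-1) (mulrC Q (z ^+ 2)).
rewrite (mulrC Q (z ^- 2)).
by apply: prefactor_inv; [exact: lmonom_neq0 | exact: (w21_neq0 gz)].
Qed.

Definition theta (n : int) : L :=
  lmonom F (r%:Z * (n * (3 * n + 1) %/ 2)%Z)
  * (lmonom F (- (3 * n * s%:Z)) - lmonom F ((3 * n + 1) * s%:Z)).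

Definition thetaP n : L := prefactor z * theta n.

Lemma thetaE n e : n * (3 * n + 1) = e * 2 -> theta n = lmonom F (r%:Z * e)
  * (lmonom F (- (3 * n * s%:Z)) - lmonom F ((3 * n + 1) * s%:Z)).
Proof. by rewrite /theta => ->; rewrite mulzK. Qed.

Lemma pentE j : j%:Z * (3 * j%:Z + 1) = (pent j)%:Z * 2.
Proof.
have : ~~ odd (j * (3 * j + 1)) by rewrite oddM oddD oddM /=; case: (odd j).
by move=> /even_halfK; rewrite -/(pent j); lia.
Qed.

Lemma prefactor_sym (P A B x : L) : P * A + - x * P * B = P * (A - x * B).
Proof. by rewrite mulrBr mulNr mulNr (mulrC x) mulrA. Qed.

(** After [prefactorV] there are four monomials. The two free of Q^(2j+1) form T_j; the other two
    form T_(-j-1), whose exponent is [pent j + 2 * j + 1]. *)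
Lemma fterm_limit j :
  prefactor z * (Q ^+ pent j * z ^- (3 * j) * (1 - Q ^+ (2 * j).+1 / z ^+ 2))
  + prefactor z^-1 * (Q ^+ pent j * z^-1 ^- (3 * j)
                       * (1 - Q ^+ (2 * j).+1 / z^-1 ^+ 2))
  = thetaP j%:Z + thetaP (- j%:Z - 1).
Proof.
have h := pentE j.
rewrite prefactorV prefactor_sym /thetaP -mulrDr; congr (_ * _).
rewrite (@thetaE j (pent j)%:Z) //.
rewrite (@thetaE (- j%:Z - 1) ((pent j)%:Z + 2 * j%:Z + 1)); last by nia.
rewrite !exprVn !invrK !lmonomXV !lmonomX !mulrBr !mulr1 !lmonomD.
rewrite opprB addrACA [RHS]addrACA [X in _ + X = _]addrC.
by congr ((lmonom F _ + lmonom F _) + (- lmonom F _ - lmonom F _)); nia.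
Qed.

Lemma gterm_limit j :
  prefactor z * (Q ^+ pent j.+1 * z ^- (3 * j.+1) * (1 - z / Q ^+ j.+1))
  + prefactor z^-1 * (Q ^+ pent j.+1 * z^-1 ^- (3 * j.+1)
                       * (1 - z^-1 / Q ^+ j.+1))
  = thetaP j.+1%:Z + thetaP (- j.+1%:Z).
Proof.
have h := pentE j.+1.
rewrite prefactorV prefactor_sym /thetaP -mulrDr; congr (_ * _).
rewrite (@thetaE j.+1 (pent j.+1)%:Z) //.
rewrite (@thetaE (- j.+1%:Z) ((pent j.+1)%:Z - j.+1%:Z)); last by nia.
rewrite !exprVn !invrK !lmonomXV !lmonomX zVE !mulrBr !mulr1 !lmonomD.
rewrite opprB addrACA [RHS]addrACA [X in _ + X = _]addrC.
by congr ((lmonom F _ + lmonom F _) + (- lmonom F _ - lmonom F _)); nia.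
Qed.

Lemma gterm0_limit :
  prefactor z * (Q ^+ pent 0 * z ^- (3 * 0) * (1 - z / Q ^+ 0)) = thetaP 0.
Proof.
rewrite /thetaP (@thetaE 0 0) // !mulr0 !mul0r oppr0 add0r mul1r.
by rewrite muln0 [Q ^+ pent 0]expr0 !expr0 invr1 mulr1 !mul1r mulr1.
Qed.

Section TermLimits.
Let zQ : vge 1 (z * Q). Proof. by apply: vge_monomM; lia. Qed.
Let zVQ : vge 1 (z^-1 * Q). Proof. by rewrite zVE; apply: vge_monomM; lia. Qed.
Let z2Q : vge 1 (z ^+ 2 * Q).
Proof. by rewrite lmonomX; apply: vge_monomM; lia. Qed.
Let zV2Q : vge 1 (z ^- 2 * Q).
Proof. by rewrite lmonomXV; apply: vge_monomM; lia. Qed.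
Let vgeMQ x : vge 1 (x * Q) -> vge 1 (Q * x * Q).
Proof.
by move=> h; rewrite -mulrA; apply: (@vgeW _ (1 + 1)) (vgeM vgeQ h).
Qed.

Lemma fterm_cvg j : lcvg (fun M => fterm Q M j z + fterm Q M j z^-1)
  (thetaP j%:Z + thetaP (- j%:Z - 1)).
Proof.
rewrite -fterm_limit; apply: lcvgD; apply: lcvg_fterm => //.
- exact: gz.
- exact: vgeMQ.
- exact: vgeMQ.
- exact: genericV gz.
- by rewrite exprVn.
- by apply: vgeMQ; rewrite invrK.
- by apply: vgeMQ; rewrite exprVn invrK.
Qed.

Lemma gterm_cvg j : lcvg (fun M => gterm Q M j.+1 z + gterm Q M j.+1 z^-1)
  (thetaP j.+1%:Z + thetaP (- j.+1%:Z)).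
Proof.
rewrite -gterm_limit; apply: lcvgD; apply: lcvg_gterm => //.
- exact: gz.
- exact: vgeMQ.
- exact: vgeMQ.
- exact: genericV gz.
- by rewrite exprVn.
- by apply: vgeMQ; rewrite invrK.
- by apply: vgeMQ; rewrite exprVn invrK.
Qed.

Lemma gterm0_cvg : lcvg (fun M => gterm Q M 0 z) (thetaP 0).
Proof.
rewrite -gterm0_limit; apply: lcvg_gterm => //.
- exact: gz.
- exact: vgeMQ.
- exact: vgeMQ.
Qed.
End TermLimits.

Lemma truncation_neg N :
  lpos (1 - \sum_(j < N.+1) (thetaP j%:Z + thetaP (- j%:Z - 1))).
Proof.
apply: (@lpos_shift_lim _ _ _ N); first by move=> M; apply: (lpos_fsum F s0 sr).
apply: lcvgD; first exact: lcvg_cst.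
apply: lcvgN; apply: (@lcvg_sum _ (fun j M => fterm Q M j z + fterm Q M j z^-1)
  (fun j => thetaP j%:Z + thetaP (- j%:Z - 1))) => j _.
exact: fterm_cvg.
Qed.

Lemma truncation_pos N :
  lpos (thetaP 0 + \sum_(j < N) (thetaP j.+1%:Z + thetaP (- j.+1%:Z)) - 1).
Proof.
apply: (@lpos_shift_lim _ _ _ N); first by move=> M; apply: (lpos_gsum F s0 sr).
apply: lcvgD; last exact: lcvg_cst.
apply: lcvgD; first exact: gterm0_cvg.
apply: (@lcvg_sum _ (fun j M => gterm Q M j.+1 z + gterm Q M j.+1 z^-1)
  (fun j => thetaP j.+1%:Z + thetaP (- j.+1%:Z))) => j _.
exact: gterm_cvg.
Qed.

End Limits.

(** * The product formula for the denominator and the signs of single terms *)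

Lemma prefactor_cancel (K : fieldType) (a b c d e f g : K) :
  a != 0 -> b != 0 -> c != 0 -> d != 0 -> e != 0 -> f != 0 -> g != 0 ->
  b^-1 * (f * g) / (a * f * d * (e * (c * g))) * (a * (c * b * (e * d))) = 1.
Proof. by move=> *; field; do ?[apply/andP; split]. Qed.

Lemma mulr_regroup (K : comRingType) (P a b c : K) :
  P * (a * (b * c)) = a * b * (P * c).
Proof. by rewrite mulrCA (mulrCA P) mulrA. Qed.

Lemma prefactor_mul1 (K : fieldType) (P x a b : K) :
  a * b != 0 -> P * ((1 - x) * a * b) = 1 -> P * (1 - x) = a^-1 * b^-1.
Proof. by move=> ab h; apply: (mulIf ab); rewrite -invfM mulVf // -[RHS]h !mulrA. Qed.

Lemma prefactor_unique (K : fieldType) (x a b c d e P : K) :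
  x != 0 -> P * ((1 - x) * a * (b * c * (d * e))) = 1 ->
  ((1 - x^-1) * b * (a * c) * (d * e))^-1 * - x^-1 = P.
Proof.
move=> x0 h; have := oner_neq0 K; rewrite -h !mulf_eq0 !negb_or.
case/and5P=> P0 /andP[x1 a0] /andP[b0 c0] d0 e0.
have x1' : x - 1 != 0 by rewrite -opprB oppr_eq0.
apply: (mulIf (_ : (1 - x) * a * (b * c * (d * e)) != 0)).
  by rewrite !mulf_neq0.
rewrite h; field.
by do ?[apply/andP; split].
Qed.

Section Denominator.
Variables (F : numFieldType) (r s : nat).
Hypotheses (s0 : (0 < s)%N) (sr : (2 * s < r)%N).
Local Notation L := (laurent F).
Local Notation Q := (lmonom F r).
Local Notation z := (lmonom F s).
Local Notation gz := (generic_z F s0 sr).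
Local Notation vQ := (vgeQ F s0 sr).

Lemma qpoch_monom_neq0 (m k : int) : 0 < m -> 0 < k ->
  qpoch (lmonom F m) (lmonom F k) != 0.
Proof.
move=> m0 k0; apply: qpoch_neq0; first by apply: vge_monomW; lia.
  by rewrite lmonom_neq1 //; lia.
by apply: vge_monomM; lia.
Qed.

Lemma oppmonom_neq1 (m : int) : m != 0 -> - lmonom F m != 1.
Proof.
move=> m0; apply/eqP => /(congr1 (@lcoef F ^~ m))/eqP.
by rewrite /= eqxx (negbTE m0) oppr_eq0 oner_eq0.
Qed.

Lemma lpos_qpochV (m k : int) : 0 < m -> 0 < k ->
  lpos (qpoch (lmonom F m) (lmonom F k))^-1.
Proof.
move=> m0 k0; apply: (@lpos_lim _ (fun n => (po (lmonom F k) (lmonom F m) n)^-1)).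
  by move=> n; apply: lpos_poV; lia.
apply: lcvgV; first exact: qpoch_monom_neq0.
by apply: po_cvg; [apply: vge_monomW; lia | apply: vge_monomM; lia].
Qed.

(** The reciprocal of [prefactor r z] without its factor (z; Q)_oo; see [prefactor_rest]. *)
Definition quintuple_rest : L := qpoch (Q / z) Q * qpoch Q Q
  * (qpoch (Q / z ^+ 2) (Q ^+ 2) * qpoch (z ^+ 2 * Q) (Q ^+ 2)).

Lemma rest_neq0 : quintuple_rest != 0.
Proof.
rewrite /quintuple_rest zVE lmonomXV !lmonomX !lmonomD.
by rewrite !mulf_neq0 //; apply: qpoch_monom_neq0; lia.
Qed.

Lemma lpos_restV : lpos quintuple_rest^-1.
Proof.
rewrite /quintuple_rest zVE lmonomXV !lmonomX !lmonomD !invfM.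
by apply: lposM; apply: lposM; apply: lpos_qpochV; lia.
Qed.

Lemma qpoch_z : qpoch z Q = (1 - z) * qpoch (z * Q) Q.
Proof. by apply: (qpochS vQ); apply: vge_monomM; lia. Qed.

(** Splitting (z^2; Q)_oo and (Q/z^2; Q)_oo by parity produces (z^2; Q^2)_oo and (Q^2/z^2; Q^2)_oo.
    These factor by [qpoch_sqr], and the halves with a minus sign cancel the numerator of
    [prefactor]. *)
Lemma prefactor_rest : prefactor r z * (qpoch z Q * quintuple_rest) = 1.
Proof.
have h1 : qpoch (z ^+ 2) Q = qpoch z Q * qpoch (- z) Q * qpoch (z ^+ 2 * Q) (Q ^+ 2).
  rewrite (@qpoch_split _ (z ^+ 2) _ vQ) ?(@qpoch_sqr _ z _ vQ) //.
    by apply: vge_monomM; lia.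
  by rewrite lmonomX; apply: vge_monomM; lia.
have h2 : qpoch (Q / z ^+ 2) Q =
    qpoch (Q / z ^+ 2) (Q ^+ 2) * (qpoch (Q / z) Q * qpoch (- (Q / z)) Q).
  rewrite (qpoch_split vQ); last first.
    by rewrite lmonomXV lmonomD; apply: vge_monomM; lia.
  have -> : Q / z ^+ 2 * Q = (Q / z) ^+ 2 by rewrite exprMn exprVn mulrAC.
  rewrite (@qpoch_sqr _ (Q / z) _ vQ) // zVE lmonomD.
  by apply: vge_monomM; lia.
rewrite /prefactor h1 h2 /quintuple_rest.
have n1 : qpoch z Q != 0 by apply: qpoch_monom_neq0; lia.
have n2 : qpoch Q Q != 0 by apply: qpoch_monom_neq0; lia.
have n3 : qpoch (Q / z) Q != 0.
  by rewrite zVE lmonomD; apply: qpoch_monom_neq0; lia.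
have n4 : qpoch (z ^+ 2 * Q) (Q ^+ 2) != 0.
  by rewrite !lmonomX lmonomD; apply: qpoch_monom_neq0; lia.
have n5 : qpoch (Q / z ^+ 2) (Q ^+ 2) != 0.
  by rewrite lmonomXV lmonomX lmonomD; apply: qpoch_monom_neq0; lia.
have n6 : qpoch (- z) Q != 0.
  apply: (qpoch_neq0 vQ); first by apply: oppmonom_neq1; lia.
  by rewrite mulNr; apply/vgeN/vge_monomM; lia.
have n7 : qpoch (- (Q / z)) Q != 0.
  rewrite zVE lmonomD; apply: (qpoch_neq0 vQ); first by apply: oppmonom_neq1; lia.
  by rewrite mulNr; apply/vgeN/vge_monomM; lia.
exact: (prefactor_cancel n1 n2 n3 n4 n5 n6 n7).
Qed.

(** The denominator of the theorem has 1/z and zQ where [prefactor_rest] has z and Q/z. Only first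
    factors differ, and 1 - 1/z = -(1 - z)/z accounts for [- z^-1]. *)
Lemma prefactor_den : (qpoch z^-1 Q * (qpoch (z * Q) Q * qpoch Q Q)
  * (qpoch (Q / z ^+ 2) (Q ^+ 2) * qpoch (z ^+ 2 * Q) (Q ^+ 2)))^-1 * - z^-1
  = prefactor r z.
Proof.
have h := prefactor_rest; rewrite qpoch_z in h.
rewrite (qpochS vQ (x := z^-1)); last by rewrite zVE; apply: vge_monomM; lia.
rewrite (mulrC z^-1 Q).
by apply: prefactor_unique h; apply: lmonom_neq0.
Qed.

(** Multiplication by 1 - z removes the first factor of (z; Q)_oo from the denominator, leaving only
    inverses of products of 1 - q^m with m > 0. *)
Lemma lpos_prefactor1 : lpos (prefactor r z * (1 - z)).
Proof.
have h := prefactor_rest; rewrite qpoch_z in h.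
have n1 : qpoch (z * Q) Q != 0.
  by rewrite lmonomD; apply: qpoch_monom_neq0; lia.
have -> : prefactor r z * (1 - z) = (qpoch (z * Q) Q)^-1 * quintuple_rest^-1.
  have n2 : qpoch (z * Q) Q * quintuple_rest != 0 by rewrite mulf_neq0 // rest_neq0.
  exact: prefactor_mul1 n2 h.
apply: lposM; last exact: lpos_restV.
by rewrite lmonomD; apply: lpos_qpochV; lia.
Qed.

Lemma lpos_prefactorX n : lpos (prefactor r z * (1 - z ^+ n)).
Proof.
rewrite -opprB subrX1 -mulNr opprB mulrA; apply: lposM; first exact: lpos_prefactor1.
by apply: (@lpos_sum _ _ (fun i => z ^+ i)) => i _; apply/lposX/lpos_monom.
Qed.

Lemma lpos_thetaP (n : nat) : lpos (thetaP F r s n).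
Proof.
rewrite /thetaP /theta.
have -> : lmonom F (- (3 * n%:Z * s%:Z)) - lmonom F ((3 * n%:Z + 1) * s%:Z)
  = lmonom F (- (3 * n%:Z * s%:Z)) * (1 - z ^+ (6 * n).+1).
  by rewrite mulrBr mulr1 lmonomX lmonomD; congr (_ - lmonom F _); lia.
rewrite mulr_regroup; apply: lposM; last exact: lpos_prefactorX.
by apply: lposM; apply: lpos_monom.
Qed.

(** At a negative index the second monomial of T has the lower degree, hence the sign; the quotient
    of the two is z^(6n+5). *)
Lemma lpos_thetaPN (n : nat) : lpos (- thetaP F r s (- n%:Z - 1)).
Proof.
rewrite /thetaP /theta.
have -> : lmonom F (- (3 * (- n%:Z - 1) * s%:Z))
    - lmonom F ((3 * (- n%:Z - 1) + 1) * s%:Z)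
  = - (lmonom F ((3 * (- n%:Z - 1) + 1) * s%:Z) * (1 - z ^+ (6 * n + 5))).
  have eqB (a b : L) : - (a * (1 - b)) = a * b - a by rewrite mulrBr mulr1 opprB.
  by rewrite eqB lmonomX lmonomD; congr (lmonom F _ - _); lia.
rewrite mulrN mulrN opprK mulr_regroup; apply: lposM; last exact: lpos_prefactorX.
by apply: lposM; apply: lpos_monom.
Qed.

End Denominator.

(** * Sums over integer intervals as ordinal sums *)

Lemma fsum_itv (V : zmodType) (f : int -> V) (a : int) (m : nat) :
  \sum_(n \in `[a, a + m%:Z]) f n = \sum_(i < m.+1) f (a + i%:Z).
Proof.
have mem_seq n : (n \in [seq a + i%:Z | i <- iota 0 m.+1]) = (a <= n <= a + m%:Z).
  apply/mapP/andP => [[i]|[an nm]]; first by rewrite mem_iota => im ->; split; lia.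
  by exists `|n - a|%N; [rewrite mem_iota; lia | lia].
have uniq_seq : uniq [seq a + i%:Z | i <- iota 0 m.+1].
  rewrite map_inj_uniq ?iota_uniq //; by move=> i j; lia.
rewrite (fsbigE [seq a + i%:Z | i <- iota 0 m.+1]) //; last 2 first.
- by move=> n /=; rewrite mem_seq in_itv.
- by move=> n; rewrite mem_seq /= in_itv /= => ->.
rewrite big_seq_cond (eq_bigl (fun n => n \in [seq a + i%:Z | i <- iota 0 m.+1])).
  rewrite -big_seq (big_map (fun i : nat => a + i%:Z) xpredT).
  by rewrite -(big_mkord xpredT (fun i => f (a + i%:Z))) /index_iota subn0.
move=> n; rewrite mem_seq; apply: andb_idr => h.
by apply/mem_set; rewrite /= in_itv.
Qed.

Lemma fsum_itv_cross (V : zmodType) (f : int -> V) (p n : nat) :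
  \sum_(i \in `[- p%:Z - 1, n%:Z]) f i =
  \sum_(j < p.+1) f (- j%:Z - 1) + \sum_(j < n.+1) f j%:Z.
Proof.
have -> : n%:Z = - p%:Z - 1 + (p.+1 + n)%N%:Z by lia.
rewrite fsum_itv -addnS big_split_ord /=; congr (_ + _).
  rewrite (reindex_inj rev_ord_inj) /=; apply: eq_bigr => i _.
  by congr f; have := ltn_ord i; lia.
by apply: eq_bigr => i _; congr f; lia.
Qed.

Lemma fsum_itv_gt (V : zmodType) (f : int -> V) (a b : int) : b < a ->
  \sum_(n \in `[a, b]) f n = 0.
Proof. by move=> ba; rewrite set_itv_ge ?fsbig_set0 // bnd_simp -ltNge. Qed.

Lemma big_ordD (V : zmodType) (f : nat -> V) n d :
  \sum_(j < (n + d)%N) f j = \sum_(j < n) f j + \sum_(j < d) f (n + j)%N.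
Proof. by rewrite big_split_ord. Qed.

(** * Sign analysis for arbitrary limits of summation, with [U n] in the role of P T_n *)

Section SignedSum.
Variables (F : numFieldType) (U : int -> laurent F).
Hypothesis U_ge0 : forall n : nat, lpos (U n%:Z).
Hypothesis U_lt0 : forall n : nat, lpos (- U (- n%:Z - 1)).
Hypothesis U_neg : forall N,
  lpos (1 - \sum_(j < N.+1) (U j%:Z + U (- j%:Z - 1))).
Hypothesis U_pos : forall N,
  lpos (U 0 + \sum_(j < N) (U j.+1%:Z + U (- j.+1%:Z)) - 1).

Lemma lpos_coef1 (f : laurent F) k : 1 <= k -> lpos (f - 1) -> 0 <= lcoef f k.
Proof.
move=> k1 /(_ k) /=; have -> : (k == 0) = false by lia.
by rewrite mulr0n subr0.
Qed.

Lemma lpos_coefN1 (f : laurent F) k : 1 <= k -> lpos (f + 1) -> 0 <= lcoef f k.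
Proof.
move=> k1 /(_ k) /=; have -> : (k == 0) = false by lia.
by rewrite mulr0n addr0.
Qed.

(** An interval on one side of 0 has terms of a single sign. Otherwise a nearly symmetric window
    around 0 is taken out; the leftover terms share one sign, and the 1 in the window estimate
    affects only the coefficient of q^0. *)
Lemma lpos_signed_sum (a b k : int) : 1 <= k ->
  0 <= lcoef ((Sg (a + b))%:~R * \sum_(n \in `[a, b]) U n) k.
Proof.
move=> k1; have [ba|ab] := ltP b a; first by rewrite fsum_itv_gt // mulr0.
have [a0|a0] := leP 0 a.
  rewrite /Sg ifT ?mul1r; last lia.
  have -> : b = a + `|b - a|%N%:Z by lia.
  rewrite fsum_itv; apply: (@lpos_sum _ _ (fun i => U (a + i%:Z))) => i _.
  by have -> : a + i%:Z = (`|a| + i)%N%:Z by lia.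
have [b0|b0] := ltP b 0.
  rewrite /Sg ifF ?mulN1r; last lia.
  have -> : b = a + `|b - a|%N%:Z by lia.
  rewrite fsum_itv -sumrN.
  apply: (@lpos_sum _ _ (fun i => - U (a + i%:Z))) => i im.
  have -> : a + i%:Z = - (`|a|.-1 - i)%N%:Z - 1 by lia.
  exact: U_lt0.
have [p ->] : exists p : nat, a = - p%:Z - 1 by exists `|a|.-1; lia.
have [n ->] : exists n : nat, b = n%:Z by exists `|b|%N; lia.
rewrite fsum_itv_cross; have [pn|np] := leqP p.+1 n.
  rewrite /Sg ifT ?mul1r; last lia.
  apply: lpos_coef1 => //.
  (* Here a + b = n - p - 1 >= 0: the window is -p-1, ..., p+1, and the [d] remaining indices are
     positive. *)
  have [d ->] : exists d, n.+1 = (p.+2 + d)%N by exists (n.+1 - p.+2)%N; lia.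
  have := U_pos p.+1; rewrite big_split /=.
  set x := \sum_(_ < _) _; set y := \sum_(_ < _) _ => h.
  have -> : \sum_(j < p.+1) U (- j%:Z - 1) = y.
    by apply: eq_bigr => j _; congr U; lia.
  rewrite (big_ordD (fun j => U j%:Z)) big_ord_recl /= -/x.
  set t := \sum_(_ < d) _.
  have -> : y + (U 0 + x + t) - 1 = U 0 + (x + y) - 1 + t by ring.
  by apply: lposD => //; apply: (@lpos_sum _ _ (fun j => U (p.+2 + j)%N%:Z)).
rewrite /Sg ifF ?mulN1r; last lia.
apply: lpos_coefN1 => //.
(* Here a + b < 0: the window is -n-1, ..., n, and the [d] remaining indices are negative. *)
have [d ->] : exists d, p.+1 = (n.+1 + d)%N by exists (p.+1 - n.+1)%N; lia.
have := U_neg n; rewrite (big_ordD (fun j => U (- j%:Z - 1))) big_split /=.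
set x := \sum_(_ < _) _; set y := \sum_(_ < _) _; set t := \sum_(_ < _) _.
move=> h; have -> : - (y + t + x) + 1 = 1 - (x + y) + - t by ring.
apply: lposD => //; rewrite /t -sumrN.
by apply: (@lpos_sum _ _ (fun j => - U (- (n.+1 + j)%N%:Z - 1))).
Qed.
End SignedSum.

(** * Reduction of the stated series to the signed sum of the P T_n *)

Theorem theorem1p3 (R S a b : int) (hR : 0 < R) (hS : 1 <= S)
    (hSR : S%:Q < R%:Q / 2) (k : int) (hk : 1 <= k) :
  let q : laurent rat := lq in
  0 <= lcoef
    ((Sg (a + b))%:~R
       / (qpochs [:: q ^ (- S); q ^ (R + S); q ^ R] (q ^ R)
          * qpochs [:: q ^ (R - 2 * S); q ^ (R + 2 * S)] (q ^ (2 * R)))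
     * \sum_(n \in `[a, b])
         q ^ (n * (3 * n + 1) * R %/ 2)%Z
           * (q ^ (3 * n * S) - q ^ (- ((3 * n + 1) * S))))
    k.
have [r Er] : exists r : nat, R = r%:Z by exists `|R|%N; lia.
have [s Es] : exists s : nat, S = s%:Z by exists `|S|%N; lia.
have s0 : (0 < s)%N by lia.
have sr : (2 * s < r)%N.
  move: hSR; rewrite Es Er ltr_pdivlMr // -[2]/(2%:~R) -rmorphM /= ltr_int.
  by lia.
cbv zeta; rewrite Er Es; set D := qpochs _ _ * qpochs _ _.
pose t n : laurent rat := lq ^ (n * (3 * n + 1) * r%:Z %/ 2)%Z
  * (lq ^ (3 * n * s%:Z) - lq ^ (- ((3 * n + 1) * s%:Z))).
rewrite -[X in lcoef (_ * X)]/(\sum_(n \in `[a, b]) t n).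
(* The summand satisfies z^(3n) - z^(-3n-1) = -(1/z) (z^(-3n) - z^(3n+1)), so the factor -1/z is
   moved to the denominator. *)
have DE : D^-1 * - (lmonom rat s)^-1 = prefactor r (lmonom rat s).
  have h := prefactor_den rat s0 sr.
  rewrite [in X in X * _](zVE rat s) lmonomXV !lmonomX !lmonomD in h.
  have e1 : r%:Z + s%:Z = s%:Z + r%:Z by lia.
  have e2 : r%:Z - 2 * s%:Z = r%:Z + - (s%:Z * 2%:Z) by lia.
  have e3 : r%:Z + 2 * s%:Z = s%:Z * 2%:Z + r%:Z by lia.
  have e4 : 2 * r%:Z = r%:Z * 2%:Z by lia.
  rewrite /D /qpochs !big_cons !big_nil !mulr1 !lqXz e1 e2 e3 e4.
  exact: h.
have tE n : D^-1 * t n = thetaP rat r s n.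
  (* By parity of [n], the integer division in the exponent is exact. *)
  have [e en] : exists e, n * (3 * n + 1) = e * 2.
    have [m [nE|nE]] : exists m, n = m * 2 \/ n = m * 2 + 1.
      by exists (n %/ 2)%Z; lia.
      by exists (m * (3 * n + 1)); rewrite nE; ring.
    by exists (n * (3 * m + 2)); rewrite nE; ring.
  rewrite /thetaP -DE -mulrA (thetaE rat r s en) /t en; congr (_ * _).
  rewrite !lqXz lmonomV mulNr mulrCA.
  have -> : (e * 2 * r%:Z %/ 2)%Z = e * r%:Z by rewrite mulrAC mulzK.
  by rewrite !lmonomBr opprB; congr (lmonom _ _ - lmonom _ _); ring.
have -> : (Sg (a + b))%:~R / D * \sum_(n \in `[a, b]) t n =
          (Sg (a + b))%:~R * \sum_(n \in `[a, b]) thetaP rat r s n.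
  rewrite -mulrA; congr (_ * _); have [ba|ab] := ltP b a.
    by rewrite !fsum_itv_gt // mulr0.
  have -> : b = a + `|b - a|%N%:Z by lia.
  by rewrite !fsum_itv mulr_sumr; apply: eq_bigr => i _.
apply: lpos_signed_sum => //.
- exact: lpos_thetaP.
- exact: lpos_thetaPN.
- exact: truncation_neg.
- exact: truncation_pos.
Qed.
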